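(* Let $M$ be a $\mathrm{II}_1$ factor. Then $$\mathcal G(M)=\tfrac12\,\mathcal G_{\mathrm{sa}}(M).$$
   Context: Let $M$ be a $\mathrm{II}_1$ factor with its faithful normal trace $\tau$, $\tau(1)=1$. Let $\mathcal P(M)$ be the collection of all finite sets of mutually orthogonal projections in $M$ which sum to $1$. For $x\in M$ and $P\in\mathcal P(M)$ put $\mathcal I(x;P)=\sum_{p,q\in P,\ pxq\neq 0}\tau(p)\tau(q)$. For a finite subset $X\subset M$ put $\mathcal I(X;P)=\sum_{x\in X}\mathcal I(x;P)$ and $\mathcal I(X)=\inf_{P\in\mathcal P(M)}\mathcal I(X;P)$. $W^*(X)$ denotes the von Neumann algebra generated by $X$ (not automatically assumed to contain the identity of $M$). Define $$\mathcal G(M)=\inf\{\mathcal I(X): X\subset M\text{ finite},\ W^*(X)=M\},$$ $$\mathcal G_{\mathrm{sa}}(M)=\inf\{\mathcal I(X): X\subset M_{\mathrm{sa}}\text{ finite},\ W^*(X)=M\},$$ where $M_{\mathrm{sa}}$ is the set of self-adjoint elements of $M$; if $M$ is not finitely generated then $\mathcal G(M)=\mathcal G_{\mathrm{sa}}(M)=\infty$. *)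

(* Defs.v *)
From HB Require Import structures.
From mathcomp Require Import all_boot all_order all_algebra.
From mathcomp Require Import all_classical all_reals all_analysis.
From mathcomp Require Import complex.

Set Implicit Arguments.
Unset Strict Implicit.
Unset Printing Implicit Defensive.

Import Order.TTheory GRing.Theory Num.Theory.
Import numFieldNormedType.Exports.

Local Open Scope classical_set_scope.
Local Open Scope ring_scope.
Local Open Scope complex_scope.

Section VonNeumannAlgebras.

Context {R : realType} {H : completeNormedModType R[i]}.
Implicit Types (dot : {dot H for Num.conj}) (x y p q v w : H -> H).
Implicit Types (M A X P D : set (H -> H)) (tau : (H -> H) -> R[i]).

(* The norm of the Banach space [H] comes from the inner product [dot]
   (linear in its first variable), i.e. [H] is a complex Hilbert space. *)
Definition hilbert dot : Prop := forall h : H, `|h| ^+ 2 = dot h h.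

Definition bounded_op : set (H -> H) := [set x | linear x /\ continuous x].

Definition is_adjoint dot x y : Prop :=
  forall h k : H, dot (x h) k = dot h (y k).

Definition op_le dot x y : Prop := forall h : H, dot (x h) h <= dot (y h) h.

Definition star_subalgebra dot A : Prop :=
  [/\ A `<=` bounded_op,
      A 0,
      forall (c : R[i]) x y, A x -> A y -> A (c *: x + y),
      forall x y, A x -> A y -> A (x \o y) &
      forall x, A x -> exists2 y, A y & is_adjoint dot x y].

(* Closed in the weak operator topology of the bounded operators; as [R[i]]
   is ordered by [a <= b] iff [b - a] is a nonnegative real, [0 < e] says
   that [e] is a positive real. *)
Definition wot_closed dot A : Prop :=
  forall x, bounded_op x ->
    (forall (s : seq (H * H)) (e : R[i]), 0 < e ->
       exists2 a, A a &
         forall hk, hk \in s -> `|dot (x hk.1 - a hk.1) hk.2| < e) ->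
    A x.

(* Not required to contain the identity operator of [H]. *)
Definition vN_algebra dot A : Prop := star_subalgebra dot A /\ wot_closed dot A.

(* The von Neumann algebra [W*(X)] generated by [X], possibly with a unit
   smaller than that of the ambient algebra. *)
Definition vN_generated dot X : set (H -> H) := smallest (vN_algebra dot) X.

Definition self_adjoint_part dot M : set (H -> H) :=
  [set x | M x /\ is_adjoint dot x x].

Definition projections dot M : set (H -> H) :=
  [set p | [/\ M p, is_adjoint dot p p & p \o p = p]].

(* The unit of [M] is the identity operator of [H <> 0]. *)
Definition factor dot M : Prop :=
  [/\ vN_algebra dot M,
      M idfun,
      (idfun : H -> H) <> 0 &
      forall z, M z -> (forall x, M x -> z \o x = x \o z) ->
        exists c : R[i], z = c *: (idfun : H -> H)].

(* Murray-von Neumann equivalence: [p = v* v] and [q = v v*]. *)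
Definition MvN_equiv dot M p q : Prop :=
  exists v w, [/\ M v, is_adjoint dot v w, w \o v = p & v \o w = q].

Definition finite_projection dot M p : Prop :=
  forall q, projections dot M q -> p \o q = q -> MvN_equiv dot M p q -> q = p.

Definition abelian_projection M p : Prop :=
  forall x y, M x -> M y ->
    (p \o x \o p) \o (p \o y \o p) = (p \o y \o p) \o (p \o x \o p).

Definition II1_factor dot M : Prop :=
  [/\ factor dot M,
      finite_projection dot M idfun &
      forall p, projections dot M p -> abelian_projection M p -> p = 0].

Definition directed dot D : Prop :=
  D !=set0 /\
  forall x y, D x -> D y -> exists z, [/\ D z, op_le dot x z & op_le dot y z].

Definition op_sup dot M D x : Prop :=
  [/\ self_adjoint_part dot M x,
      forall d, D d -> op_le dot d x &
      forall y, self_adjoint_part dot M y ->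
        (forall d, D d -> op_le dot d y) -> op_le dot x y].

(* [tau] is a faithful normal tracial state of [M]; its values outside [M]
   are irrelevant. *)
Definition faithful_normal_trace dot M tau : Prop :=
  [/\ forall (c : R[i]) x y, M x -> M y -> tau (c *: x + y) = c * tau x + tau y,
      forall x y, M x -> M y -> is_adjoint dot x y -> 0 <= tau (y \o x),
      forall x y, M x -> M y -> tau (x \o y) = tau (y \o x) &
      tau idfun = 1] /\
  (forall x y, M x -> M y -> is_adjoint dot x y -> tau (y \o x) = 0 -> x = 0) /\
  (forall D x, D `<=` self_adjoint_part dot M -> directed dot D ->
     op_sup dot M D x -> supremums [set tau d | d in D] (tau x)).

Definition projection_partitions dot M : set (set (H -> H)) :=
  [set P | [/\ finite_set P,
               P `<=` projections dot M,
               forall p q, P p -> P q -> p <> q -> p \o q = 0 &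
               \sum_(p \in P) p = idfun]].

(* [tau p] is a nonnegative real for a projection [p], so that taking its real
   part loses nothing. *)
Definition I_elt tau x P : R :=
  \sum_(pq \in [set pq : (H -> H) * (H -> H) |
                 [/\ P pq.1, P pq.2 & pq.1 \o x \o pq.2 <> 0]])
    complex.Re (tau pq.1) * complex.Re (tau pq.2).

Definition I_part tau X P : R := \sum_(x \in X) I_elt tau x P.

Definition I_set dot M tau X : \bar R :=
  ereal_inf [set (I_part tau X P)%:E | P in projection_partitions dot M].

(* [ereal_inf set0 = +oo], so these are [+oo] when [M] is not finitely
   generated. *)
Definition G_gen dot M tau : \bar R :=
  ereal_inf [set I_set dot M tau X | X in
    [set X | [/\ finite_set X, X `<=` M & vN_generated dot X = M]]].

Definition G_sa dot M tau : \bar R :=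
  ereal_inf [set I_set dot M tau X | X in
    [set X | [/\ finite_set X, X `<=` self_adjoint_part dot M &
                 vN_generated dot X = M]]].

End VonNeumannAlgebras.

(* Main.v *)
(** Once the projections of a partition are available as generators, a generator
    [x] can be replaced by its corners [p x q]. If [x] is self-adjoint, the corners
    with [p <= q] for some ordering of the partition suffice, which halves the
    cost up to the diagonal; conversely the corners of an arbitrary [x] are
    recovered from the self-adjoint elements [p x q + q x* p], at twice the cost.
    Both the diagonal corners and the partition itself cost at most
    [\sum_p tau(p)^2], which is negligible if all the projections have small
    trace. Refining a partition does not increase the cost, so it remains to
    split projections finely. This is possible because a II_1 factor has no
    minimal projection: the spectral projections of a self-adjoint element of
    [p M p], with [p] minimal, would all be [0] or [p], so [p M p] would consist
    of scalars and [p] would be abelian. Spectral projections are obtained as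
    strong limits of polynomials. *)

Require Import Defs.
From HB Require Import structures.
From mathcomp Require Import all_boot all_order all_algebra.
From mathcomp Require Import all_classical all_reals all_analysis.
From mathcomp Require Import complex.
From mathcomp Require Import ring lra.
Import Order.TTheory GRing.Theory Num.Theory.
Import numFieldNormedType.Exports.
Local Open Scope classical_set_scope.
Local Open Scope ring_scope.
Set Implicit Arguments.
Unset Strict Implicit.
Unset Printing Implicit Defensive.

(** * Limits and finite sums in partially ordered fields *)

Lemma cvg_seq_unique (K : numFieldType) (V : pseudoMetricNormedZmodType K)
    (w : nat -> V) (a b : V) :
  w @ \oo --> a -> w @ \oo --> b -> a = b :> V.
Proof. by move=> wa wb; apply: (cvg_unique (@norm_hausdorff _ _) wa wb). Qed.

(** A nonnegative sequence coincides with its norms, so by continuity its limit is its own norm. No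
    total order enters, as is needed for [R[i]]. *)
Lemma seq_lim_ge0 (K : numFieldType) (u : nat -> K) (l : K) :
  u @ \oo --> l -> (forall n, 0 <= u n) -> 0 <= l.
Proof.
move=> ul u0; have ul' := cvg_norm ul.
have -> : l = `|l|; last exact: normr_ge0.
apply: (cvg_unique (@norm_hausdorff _ _) ul); move: ul'.
have -> : (fun n => `|u n|) = u by apply/funext => n; rewrite ger0_norm.
exact.
Qed.

Lemma ler_sum_seq (R : numDomainType) (I : eqType) (l : seq I) (f g : I -> R) :
  (forall i, i \in l -> f i <= g i) -> \sum_(i <- l) f i <= \sum_(i <- l) g i.
Proof. by move=> fg; rewrite big_seq [leRHS]big_seq; apply: ler_sum. Qed.

(** * Strong limits of bounded operators *)

Section Operators.
Context {R : realType} {H : completeNormedModType R[i]}.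
Implicit Types (x y : H -> H) (h k u v : H).

Lemma linD x u v : linear x -> x (u + v) = x u + x v.
Proof. by move=> lx; have := lx 1 u v; rewrite !scale1r. Qed.

Lemma lin0 x : linear x -> x 0 = 0.
Proof. by move=> lx; have := lx (-1) 0 0; rewrite scaler0 addr0 scaleN1r addNr. Qed.

Lemma linZ x c u : linear x -> x (c *: u) = c *: x u.
Proof. by move=> lx; have := lx c u 0; rewrite (lin0 lx) !addr0. Qed.

Lemma linN x u : linear x -> x (- u) = - x u.
Proof. by move=> lx; rewrite -scaleN1r linZ // scaleN1r. Qed.

Lemma linB x u v : linear x -> x (u - v) = x u - x v.
Proof. by move=> lx; rewrite linD // linN. Qed.

Lemma lin_sum I (s : seq I) (P : pred I) (F : I -> H) x : linear x ->
  x (\sum_(i <- s | P i) F i) = \sum_(i <- s | P i) x (F i).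
Proof.
by move=> lx; apply: (big_morph x _ (lin0 lx)) => u v; exact: linD.
Qed.

Lemma bounded_op_le x : bounded_op x ->
  exists2 k : R[i], 0 < k & forall h, `|x h| <= k * `|h|.
Proof.
move=> [lx cx].
pose X : {linear H -> H} := HB.pack x (GRing.isLinear.Build _ _ _ _ x lx).
have /linear_boundedP := @continuous_linear_bounded _ _ _ 0 X (cx 0).
by move=> /pinfty_ex_gt0[k k0 kx]; exists k.
Qed.

Lemma le_bounded_op x (k : R[i]) : linear x -> (forall h, `|x h| <= k * `|h|) ->
  bounded_op x.
Proof.
move=> lx xk; split=> //.
pose X : {linear H -> H} := HB.pack x (GRing.isLinear.Build _ _ _ _ x lx).
have k0 : 0 <= `|k| by [].
apply: (@bounded_linear_continuous _ _ _ X); apply/linear_boundedP.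
exists `|k|; split; first exact: normr_real.
move=> r kr h; rewrite -[X h]/(x h); have [->|h0] := eqVneq h 0.
  by rewrite (lin0 lx) normr0 mulr0.
have hp : 0 < `|h| by rewrite normr_gt0.
(* The bound at a nonzero vector forces the complex number [k] to be real: its product with a
   positive real is at least a norm. *)
have kr0 : k \is Num.real.
  have := le_trans (normr_ge0 _) (xk h); rewrite pmulr_lge0 // => /ger0_real //.
apply: le_trans (xk h) _; rewrite ler_pM2r //.
by apply: le_trans (ltW kr); exact: real_ler_norm.
Qed.

End Operators.

(** * Inner product, adjoints and pointwise limits *)

Section HilbertSpace.
Context {R : realType} {H : completeNormedModType R[i]}.
Context {dot : {dot H for Num.conj}} (hd : hilbert dot).
Implicit Types (x y : H -> H) (h k u v : H).

Lemma dotC u v : dot v u = (dot u v)^*.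
Proof. by rewrite [dot v u]hermC /= expr0 mul1r. Qed.

Lemma dotDl u v h : dot (u + v) h = dot u h + dot v h.
Proof. exact: linearDl. Qed.

Lemma dotBl u v h : dot (u - v) h = dot u h - dot v h.
Proof. exact: linearBl. Qed.

Lemma dotZl c u h : dot (c *: u) h = c * dot u h.
Proof. exact: linearZl_LR. Qed.

Lemma dotDr u v h : dot h (u + v) = dot h u + dot h v.
Proof. exact: linearDr. Qed.

Lemma dotBr u v h : dot h (u - v) = dot h u - dot h v.
Proof. exact: linearBr. Qed.

Lemma dotZr c u h : dot h (c *: u) = c^* * dot h u.
Proof. exact: linearZr_LR. Qed.

Lemma dot0l h : dot 0 h = 0.
Proof. exact: linear0l. Qed.

Lemma dot0r h : dot h 0 = 0.
Proof. exact: linear0r. Qed.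

Lemma CauchySchwarz_dot u v : `|dot u v| <= `|u| * `|v|.
Proof.
have [->|v0] := eqVneq v 0; first by rewrite dot0r !normr0 mulr0.
have vp : 0 < dot v v by rewrite dnorm_gt0.
(* The component of [u] orthogonal to [v] has nonnegative square norm. *)
have := dnorm_ge0 dot (u - (dot u v / dot v v) *: v).
rewrite dotBl !dotBr !dotZl !dotZr [dot v u]dotC.
rewrite rmorphM /= fmorphV /= (geC0_conj (ltW vp)) [_ * dot v v]divfK ?gt_eqF //.
rewrite [_ / _ * _ in X in _ - X]mulrC subrr subr0 mulrAC.
rewrite [_^* * _]mulrC -normCK subr_ge0.
rewrite ler_pdivrMr // -!hd -exprMn ler_pXn2r // nnegrE ?normr_ge0 //.
Qed.

Lemma dot_eq0 h : (forall k, dot h k = 0) -> h = 0.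
Proof. by move=> /(_ h)/eqP; rewrite dnorm_eq0 => /eqP. Qed.

Lemma dot_ext u v : (forall k, dot u k = dot v k) -> u = v.
Proof.
move=> uv; apply/eqP; rewrite -subr_eq0; apply/eqP/dot_eq0 => k.
by rewrite dotBl /= uv subrr.
Qed.

Lemma is_adjoint_sym x y : is_adjoint dot x y -> is_adjoint dot y x.
Proof. by move=> xy h k; rewrite dotC -xy -dotC. Qed.

Lemma is_adjoint_uniq x y z : is_adjoint dot x y -> is_adjoint dot x z -> y = z.
Proof.
move=> /is_adjoint_sym xy /is_adjoint_sym xz; apply/funext => h.
by apply: dot_ext => k; rewrite xy xz.
Qed.

Lemma is_adjointM x x' y y' : is_adjoint dot x x' -> is_adjoint dot y y' ->
  is_adjoint dot (x \o y) (y' \o x').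
Proof. by move=> xx yy h k /=; rewrite xx yy. Qed.

Lemma cvg_dotl (u : nat -> H) l k : u @ \oo --> l ->
  (fun n => dot (u n) k) @ \oo --> dot l k.
Proof.
move=> ul; apply/cvgrPdist_lt => e e0.
have k0 : 0 < `|k| + 1 by rewrite ltr_wpDl.
have /(cvgrPdist_lt _ _).1/(_ (e / (`|k| + 1)))  := ul.
rewrite divr_gt0 // => /(_ isT); apply: filterS => n un.
rewrite -dotBl; apply: le_lt_trans (CauchySchwarz_dot _ _) _.
rewrite ltr_pdivlMr // in un; apply: le_lt_trans un.
by rewrite ler_wpM2l // lerDl.
Qed.

Lemma norm_lim_le (u : nat -> H) l c :
  u @ \oo --> l -> (forall n, `|u n| <= c) -> `|l| <= c.
Proof.
move=> ul uc; apply/ler_addgt0Pr => e e0.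
have /(cvgrPdist_lt _ _).1/(_ e e0)[N _ /(_ N (leqnn _)) lN] := ul.
rewrite -(subrK (u N) l); apply: le_trans (ler_normD _ _) _.
by rewrite addrC lerD // ltW.
Qed.

(** Each [g h] is forced to be nonincreasing, and it is bounded below, so [T n h] is Cauchy. The
    limit is a contraction and a weak operator limit of elements of [A], hence lies in [A]. *)
Lemma op_limit A (T : nat -> H -> H) (g : H -> nat -> R) : vN_algebra dot A ->
  (forall n, A (T n)) -> (forall n h, `|T n h| <= `|h|) ->
  (forall h n, 0 <= g h n) ->
  (forall h m n, (m <= n)%N -> `|T m h - T n h| ^+ 2 <= (g h m - g h n)%:C%C) ->
  exists2 L, A L & (forall h, (fun n => T n h) @ \oo --> L h).
Proof.
move=> [[Abd _ _ _ _] Awot] AT T1 g0 Tg.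
have cvT h : cvg ((fun n => T n h) @ \oo).
  apply: cauchy_cvg; apply/cauchy_ballP => e e0.
  have e2 : 0 < (e / 2) ^+ 2 by rewrite exprn_gt0 // divr_gt0.
  pose e2r := complex.Re ((e / 2) ^+ 2).
  have e2E : (e / 2) ^+ 2 = e2r%:C%C by rewrite -(RRe_real (ger0_real (ltW e2))).
  have e2r0 : 0 < e2r by rewrite -ltcR -e2E.
  have hi : has_inf (range (g h)).
    by split; [exists (g h 0), 0%N | exists 0 => _ [n _ <-]].
  (* From a rank where [g h] is within [(e / 2)^2] of its infimum, all later increments are below
     [e / 2]. *)
  have [_ [N _ <-] gN] := inf_adherent e2r0 hi.
  have TN n : (N <= n)%N -> `|T N h - T n h| < e / 2.
    move=> Nn; rewrite -(ltr_pXn2r (n := 2)) ?nnegrE //; last first.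
      by rewrite ltW // divr_gt0.
    apply: le_lt_trans (Tg _ _ _ Nn) _; rewrite e2E ltcR ltrBlDr.
    apply: lt_le_trans gN _; rewrite addrC lerD2l.
    by apply: ge_inf; [exact: hi.2 | exists n].
  have Nev : \forall n \near \oo, `|T N h - T n h| < e / 2.
    by exists N => // n /=; exact: TN.
  exists ([set v | `|T N h - v| < e / 2], [set v | `|T N h - v| < e / 2]).
    by split.
  move=> [u v] [/= mN nN]; rewrite -ball_normE /= (splitr e).
  apply: le_lt_trans (ltrD mN nN); rewrite [X in _ <= X + _]distrC.
  by apply: le_trans (ler_normD _ _); rewrite addrA subrK.
pose L h := lim ((fun n => T n h) @ \oo).
have TL h : (fun n => T n h) @ \oo --> L h by exact: cvT.
exists L => //; apply: Awot.
  apply: (@le_bounded_op _ _ _ 1) => [c u v|h]; last first.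
    by rewrite mul1r; apply: norm_lim_le (TL h) _ => n.
  apply: (cvg_lim (@norm_hausdorff _ _)).
  have -> : (fun n => T n (c *: u + v)) = (fun n => c *: T n u + T n v).
    by apply/funext => n; have [/(_ c u v)] := Abd _ (AT n).
  by apply: cvgD => //; apply: cvgZr.
move=> s e e0.
(* A weak neighbourhood tests only finitely many pairs, so one rank serves all of them. *)
suff [N TN] : exists N, forall n, (N <= n)%N -> forall hk, hk \in s ->
    `|dot (L hk.1 - T n hk.1) hk.2| < e.
  by exists (T N) => //; exact: TN.
elim: s => [|[h k] s [N IH]]; first by exists 0%N.
have := cvg_dotl (k := k) (TL h) => /cvgrPdist_lt/(_ e e0)[N' _ N'P].
exists (maxn N N') => n; rewrite geq_max => /andP[Nn N'n] hk.
rewrite in_cons => /orP[/eqP -> /=|]; last exact: IH.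
by rewrite dotBl /=; exact: N'P.
Qed.

End HilbertSpace.

Section StrongLimits.
Context {R : realType} {H : completeNormedModType R[i]}.
Context {dot : {dot H for Num.conj}} (hd : hilbert dot).
Context {M : set (H -> H)} (vM : vN_algebra dot M) (M1 : M idfun).
Implicit Types (x y z a b c p q E : H -> H) (h k u v : H).

Lemma vN_bounded x : M x -> bounded_op x.
Proof. by case: vM => -[+ _ _ _ _] _; exact. Qed.

Lemma vN_linear x : M x -> linear x.
Proof. by move=> /vN_bounded[]. Qed.

Lemma vNP (t : R[i]) x y : M x -> M y -> M (fun h => t *: x h + y h).
Proof. by case: vM => -[_ _ + _ _] _; exact. Qed.

Lemma vN0 : M (fun=> 0).
Proof. by case: vM => -[]. Qed.

Lemma vNM x y : M x -> M y -> M (x \o y).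
Proof. by case: vM => -[_ _ _ + _] _; exact. Qed.

Lemma vN_adj x : M x -> exists2 y, M y & is_adjoint dot x y.
Proof. by case: vM => -[_ _ _ _ +] _; exact. Qed.

Lemma vNZ (t : R[i]) x : M x -> M (fun h => t *: x h).
Proof.
move=> Mx; have := vNP t Mx vN0; congr (M _).
by apply/funext => h; rewrite addr0.
Qed.

Lemma vND x y : M x -> M y -> M (fun h => x h + y h).
Proof.
move=> Mx My; have := vNP 1 Mx My; congr (M _).
by apply/funext => h; rewrite scale1r.
Qed.

Lemma vNB x y : M x -> M y -> M (fun h => x h - y h).
Proof.
move=> Mx My; have := vNP (-1) My Mx; congr (M _).
by apply/funext => h; rewrite scaleN1r addrC.
Qed.

Lemma dot_norm h : dot h h = `|h| ^+ 2.
Proof. by rewrite hd. Qed.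

(** The square norm of [h - x^2 h] is [|h|^2 - 2 |x h|^2 + |x^2 h|^2], and the last term is at most
    [|x h|^2]. *)
Lemma sa_contraction_1sub x : is_adjoint dot x x -> (forall h, `|x h| <= `|h|) ->
  is_adjoint dot (fun h => h - x (x h)) (fun h => h - x (x h)) /\
  forall h, `|h - x (x h)| <= `|h|.
Proof.
move=> sx x1; split=> [h k|h]; first by rewrite dotBl dotBr !sx.
rewrite -(ler_pXn2r (n := 2)) ?nnegrE // -!dot_norm dotBl !dotBr.
rewrite (sx (x h) h) -[dot h (x (x h))]sx !dot_norm.
have : `|x (x h)| ^+ 2 <= `|x h| ^+ 2 by rewrite ler_pXn2r ?nnegrE.
have : 0 <= `|x h| ^+ 2 by rewrite exprn_ge0.
move: (`|h| ^+ 2) (`|x h| ^+ 2) (`|x (x h)| ^+ 2) => A B C B0 CB.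
rewrite -subr_ge0; have -> : A - (A - B - (B - C)) = (B - C) + B by ring.
by rewrite addr_ge0 // subr_ge0.
Qed.

Lemma cvg_dotr (u : nat -> H) l k : u @ \oo --> l ->
  (fun n => dot k (u n)) @ \oo --> dot k l.
Proof.
move=> ul; apply/cvgrPdist_lt => e e0.
have := cvg_dotl hd (k := k) ul => /cvgrPdist_lt/(_ e e0).
apply: filterS => n; rewrite -dotBl -dotBr -norm_conjC.
by rewrite [dot k _]dotC.
Qed.

Lemma lim_sa (T : nat -> H -> H) L : (forall n, is_adjoint dot (T n) (T n)) ->
  (forall h, (fun n => T n h) @ \oo --> L h) -> is_adjoint dot L L.
Proof.
move=> sT TL h k; apply: (cvg_seq_unique (cvg_dotl hd (k := k) (TL h))).
have -> : (fun n => dot (T n h) k) = (fun n => dot h (T n k)).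
  by apply/funext => n; rewrite sT.
exact: cvg_dotr.
Qed.

Lemma lim_comm (T : nat -> H -> H) L y : (forall n h, y (T n h) = T n (y h)) ->
  (forall h, (fun n => T n h) @ \oo --> L h) -> bounded_op y ->
  forall h, y (L h) = L (y h).
Proof.
move=> yT TL [_ cy] h; apply: (cvg_seq_unique _ (TL (y h))).
have -> : (fun n => T n (y h)) = (fun n => y (T n h)) by apply/funext.
by apply: continuous_cvg => //; exact: cy.
Qed.

Lemma iter_adj c n h k : is_adjoint dot c c ->
  dot (iter n c h) k = dot h (iter n c k).
Proof. by move=> sc; elim: n h k => //= n IH h k; rewrite sc IH -iterSr. Qed.

Lemma iter_contraction c n h : (forall h, `|c h| <= `|h|) -> `|iter n c h| <= `|h|.
Proof. by move=> c1; elim: n => //= n; apply: le_trans. Qed.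

Lemma iter_vN c n : M c -> M (iter n c).
Proof. by move=> Mc; elim: n => //= n IH; apply: vNM Mc IH. Qed.

(* The even powers of [c] decrease strongly to the projection onto the kernel
   of [1 - c^2]. *)
Lemma ker_projection c : M c -> is_adjoint dot c c ->
  (forall h, `|c h| <= `|h|) ->
  exists2 E, projections dot M E &
   [/\ forall h, c (c h) = h -> E h = h, forall h, c (c (E h)) = E h &
       forall y, bounded_op y -> (forall h, y (c h) = c (y h)) ->
         forall h, y (E h) = E (y h)].
Proof.
move=> Mc sc c1.
pose T n := iter n.*2 c.
pose N h n : R := complex.Re (`|iter n c h| ^+ 2).
have NE h n : `|iter n c h| ^+ 2 = (N h n)%:C%C.
  by rewrite RRe_real // ger0_real // exprn_ge0.
have Ndec h m n : (m <= n)%N -> N h n <= N h m.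
  move=> mn; rewrite -lecR -!NE ler_pXn2r ?nnegrE // -(subnK mn) iterD.
  exact: iter_contraction.
(* These inner products depend on [m + n] only, so the square norm of [T m h - T n h] is
   [N (2m) - 2 N (m+n) + N (2n)]. As [N] decreases, this is at most [N (2m) - N (2n)] for
   [m <= n]. *)
have dT h m n : dot (T m h) (T n h) = (N h (m + n)%N)%:C%C.
  rewrite iter_adj // -iterD -doubleD -addnn iterD -iter_adj //.
  by rewrite dot_norm NE.
have [||||E ME TE] := @op_limit _ _ _ hd M T (fun h n => N h n.*2) vM.
- by move=> n; exact: iter_vN.
- by move=> n h; exact: iter_contraction.
- by move=> h n; rewrite -ler0c -NE exprn_ge0.
- move=> h m n mn; rewrite -dot_norm dotBl !dotBr !dT -!rmorphB lecR /=.
  rewrite !addnn [(n + m)%N]addnC.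
  have : N h n.*2 <= N h (m + n)%N by apply: Ndec; rewrite -addnn leq_add2r.
  lra.
have ccE h : c (c (E h)) = E h.
  apply: (cvg_seq_unique _ (TE h)).
  rewrite -cvg_shiftS.
  have -> : (fun n => T n.+1 h) = (fun n => (c \o c) (T n h)) by apply/funext.
  apply: continuous_cvg; last exact: TE.
  by have [_] := vN_bounded (vNM Mc Mc); exact.
have Efix : forall h, c (c h) = h -> E h = h.
  move=> h cch; apply: (cvg_seq_unique (TE h)).
  have -> : (fun n => T n h) = (fun=> h); last exact: cvg_cst.
  by apply/funext; elim=> // n IH; rewrite /T doubleS 2!iterS -/(T n h) IH.
exists E; last first.
  split=> // y by_ yc h; apply: lim_comm TE by_ _ => n {}h.
  by rewrite /T; elim: n.*2 h => // k IH h; rewrite !iterS yc IH.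
split=> //; last by apply/funext => h /=; apply: Efix.
by apply: lim_sa TE => n h k; rewrite iter_adj.
Qed.

End StrongLimits.

(** * Spectral projections *)

Section SquareRoots.
Context {R : realType} {H : completeNormedModType R[i]}.
Context {dot : {dot H for Num.conj}} (hd : hilbert dot).
Context {M : set (H -> H)} (vM : vN_algebra dot M) (M1 : M idfun).
Implicit Types (x y z a b c p q E : H -> H) (h k u v : H).

(* Solves [2 z = b + z^2] by iteration; [1 - z] is then the square root of
   [1 - b]. The error bounds come from the scalar iteration with [b = 1]. *)
Lemma sqrt_1sub b : M b -> is_adjoint dot b b -> (forall h, `|b h| <= `|h|) ->
  exists z, [/\ M z, is_adjoint dot z z, forall h, `|z h| <= `|h|,
    forall h, z h *+ 2 = b h + z (z h) &
    forall y, bounded_op y -> (forall h, y (b h) = b (y h)) ->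
      forall h, y (z h) = z (y h)].
Proof.
move=> Mb sb b1.
pose F z h : H := 2^-1 *: (b h + z (z h)).
pose T n : H -> H := iter n F (fun=> 0).
pose t n : R[i] := iter n (fun s => 2^-1 * (1 + s ^+ 2)) 0.
have TS n h : T n.+1 h = 2^-1 *: (b h + T n (T n h)) by [].
have tS n : t n.+1 = 2^-1 * (1 + t n ^+ 2) by [].
have i2 : 0 <= 2^-1 :> R[i] by rewrite invr_ge0.
have t0 n : 0 <= t n.
  elim: n => [//|n IH]; rewrite tS mulr_ge0 // addr_ge0 // exprn_ge0 //.
have t1 n : t n <= 1.
  elim: n => [|n IH]; first exact: ler01.
  rewrite tS ler_pdivrMl // mulr1 (_ : 2 = 1 + 1) // lerD2l expr_le1 //.
have td n : 0 <= t n.+1 - t n.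
  have -> : t n.+1 - t n = 2^-1 * (1 - t n) ^+ 2 by rewrite tS; field.
  by rewrite mulr_ge0 // exprn_ge0 // subr_ge0.
have MT n : M (T n).
  elim: n => [|n IH]; first exact: (vN0 vM).
  by apply/(vNZ vM)/(vND vM Mb)/(vNM vM).
have sT n : is_adjoint dot (T n) (T n).
  elim: n => [h k|n IH h k]; first by rewrite dot0l dot0r.
  rewrite !TS dotZl dotZr dotDl dotDr sb !IH.
  by rewrite (geC0_conj i2).
have Tt n h : `|T n h| <= t n * `|h|.
  elim: n h => [|n IH] h; first by rewrite normr0 mul0r.
  rewrite TS tS normrZ (ger0_norm i2) -mulrA ler_wpM2l //.
  apply: le_trans (ler_normD _ _) _; rewrite mulrDl mul1r lerD //.
  apply: le_trans (IH _) _; rewrite expr2 -mulrA ler_wpM2l //.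
have T1 n h : `|T n h| <= `|h|.
  apply: le_trans (Tt n h) _; rewrite -[leRHS]mul1r ler_wpM2r //.
have lT n : linear (T n) by exact: (vN_linear vM).
have Td n h : `|T n.+1 h - T n h| <= (t n.+1 - t n) * `|h|.
  elim: n h => [|n IH] h.
    rewrite TS tS subr0 !addr0 expr0n addr0 subr0 mulr1 normrZ (ger0_norm i2).
    by rewrite ler_wpM2l.
  rewrite TS [T n.+1 h in X in _ - X]TS.
  (* Difference of squares without commutation: [S S - T T = S (S - T) + (S - T) T]. The scalar
     increments obey the same recursion. *)
  have -> : 2^-1 *: (b h + T n.+1 (T n.+1 h)) - 2^-1 *: (b h + T n (T n h)) =
    2^-1 *: (T n.+1 (T n.+1 h - T n h) + (T n.+1 (T n h) - T n (T n h))).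
    rewrite -scalerBr; congr (_ *: _); rewrite (linB _ _ (lT n.+1)) addrA subrK.
    by rewrite opprD addrACA subrr add0r.
  have -> : t n.+2 - t n.+1 =
    2^-1 * (t n.+1 * (t n.+1 - t n) + (t n.+1 - t n) * t n).
    by rewrite [t n.+2]tS [X in _ - X]tS; ring.
  rewrite normrZ (ger0_norm i2) -mulrA ler_wpM2l //.
  apply: le_trans (ler_normD _ _) _; rewrite mulrDl lerD // -mulrA.
    by apply: le_trans (Tt _ _) _; rewrite ler_wpM2l.
  by apply: le_trans (IH _) _; rewrite ler_wpM2l.
have tmono m n : (m <= n)%N -> 0 <= t n - t m.
  move=> mn; rewrite -(subnK mn); elim: (n - m)%N => [|k IH].
    by rewrite add0n subrr.
  by rewrite addSn -(subrK (t (k + m)%N) (t _.+1)) -addrA addr_ge0.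
have TD m n h : (m <= n)%N -> `|T n h - T m h| <= (t n - t m) * `|h|.
  move=> mn; rewrite -(subnK mn); elim: (n - m)%N => [|k IH].
    by rewrite add0n !subrr normr0 mul0r.
  rewrite addSn; have -> : T (k + m).+1 h - T m h =
    T (k + m).+1 h - T (k + m)%N h + (T (k + m)%N h - T m h).
    by rewrite addrA subrK.
  have -> : t (k + m).+1 - t m = t (k + m).+1 - t (k + m)%N + (t (k + m)%N - t m).
    by rewrite addrA subrK.
  by rewrite mulrDl; apply: le_trans (ler_normD _ _) _; rewrite lerD.
(* The gap [1 - t n] decreases within [[0, 1]], where squaring an increment only makes it smaller;
   the limit of [t] is never computed. *)
pose g h n : R := complex.Re ((1 - t n) * `|h| ^+ 2).
have gE h n : (g h n)%:C%C = (1 - t n) * `|h| ^+ 2.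
  by rewrite RRe_real // ger0_real // mulr_ge0 ?exprn_ge0 // subr_ge0.
have [||z Mz Tz] := @op_limit _ _ _ hd M T g vM MT T1.
- by move=> h n; rewrite -ler0c gE mulr_ge0 ?exprn_ge0 // subr_ge0.
- move=> h m n mn; rewrite rmorphB /= !gE.
  rewrite distrC; have := TD m n h mn.
  rewrite -(ler_pXn2r (n := 2)) ?nnegrE //; last by rewrite mulr_ge0 // tmono.
  move/le_trans; apply.
  rewrite exprMn -mulrBl ler_wpM2r ?exprn_ge0 //.
  have -> : 1 - t m - (1 - t n) = t n - t m by ring.
  rewrite expr2 -[leRHS]mulr1 ler_wpM2l ?tmono //.
  by rewrite lerBlDr (le_trans (t1 _)) // lerDl.
have z1 h : `|z h| <= `|h| by apply: norm_lim_le (Tz h) _ => n.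
have lz := vN_linear vM Mz.
(* Operator and argument vary together; the error [T n (T n h - z h)] vanishes because the [T n] are
   contractions. *)
have Tzz h : (fun n => T n (T n h)) @ \oo --> z (z h).
  have -> : (fun n => T n (T n h)) =
      (fun n => T n (T n h - z h)) \+ (fun n => T n (z h)).
    by apply/funext => n /=; rewrite (linB _ _ (lT n)) subrK.
  rewrite -[z (z h)]add0r; apply: cvgD; last exact: Tz.
  apply/cvgrPdist_lt => e e0.
  have /(cvgrPdist_lt _ _).1/(_ e e0) := Tz h.
  apply: filterS => n; rewrite sub0r normrN distrC; apply: le_lt_trans.
  exact: T1.
exists z; split=> //.
- exact: (lim_sa hd sT Tz).
- move=> h; rewrite mulr2n.
  have TSz : (fun n => T n.+1 h) @ \oo --> z h by rewrite (cvg_shiftS (T^~ h)).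
  apply: (cvg_seq_unique (cvgD TSz TSz)).
  rewrite (_ : _ + _ = (fun n => b h + T n (T n h))); last first.
    apply/funext => n; rewrite -[LHS]/(T n.+1 h + T n.+1 h) -mulr2n TS.
    by rewrite -scaler_nat scalerA mulfV ?scale1r // pnatr_eq0.
  by apply: cvgD (Tzz h); exact: cvg_cst.
- move=> y by_ yb h; apply: (lim_comm _ Tz by_) => {h} n.
  elim: n => [|n IH] h; first by rewrite (lin0 by_.1).
  by have ly := by_.1; rewrite !TS (linZ _ _ ly) (linD _ _ ly) yb !IH.
Qed.

Lemma dot_sa_real a h : is_adjoint dot a a -> dot (a h) h \is Num.real.
Proof. by move=> sa; apply/CrealP; rewrite -dotC sa. Qed.

(** This [y] is the absolute value of [a]. With [b = 1 - a^2] and [2 z = b + z^2], the operator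
    [1 - z] squares to [1 - b = a^2]; it is positive because [z] is a contraction. *)
Lemma sqrt_sqr a : M a -> is_adjoint dot a a -> (forall h, `|a h| <= `|h|) ->
  exists y, [/\ M y, is_adjoint dot y y, forall h, 0 <= dot (y h) h,
    forall h, y (y h) = a (a h) &
    forall x, bounded_op x -> (forall h, x (a h) = a (x h)) ->
      forall h, x (y h) = y (x h)].
Proof.
move=> Ma sa a1; have [sb b1] := sa_contraction_1sub hd sa a1.
have Mb : M (fun h => h - a (a h)) by exact: (vNB vM M1 (vNM vM Ma Ma)).
have [z [Mz sz z1 zb zC]] := sqrt_1sub Mb sb b1.
exists (fun h => h - z h); split.
- exact: (vNB vM M1 Mz).
- by move=> h k; rewrite dotBl dotBr sz.
- move=> h; rewrite dotBl subr_ge0.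
  apply: le_trans (real_ler_norm (dot_sa_real _ sz)) _.
  apply: le_trans (CauchySchwarz_dot hd _ _) _.
  by rewrite (dot_norm hd) expr2 ler_wpM2r.
- move=> h; have zE : z (z h) = z h + z h - (h - a (a h)).
    by rewrite -mulr2n zb addrAC subrr add0r.
  rewrite (linB _ _ (vN_linear vM Mz)) zE; move: (z h) (a (a h)) => u v.
  have -> : u - (u + u - (h - v)) = h - v - u.
    by rewrite opprB addrCA opprD [u + (_ - _)]addrA subrr add0r.
  by rewrite opprB addrA subrK opprB addrC subrK.
- move=> x bx xa h; have lx := bx.1; rewrite (linB _ _ lx) zC // => {}h.
  by rewrite (linB _ _ lx) !xa.
Qed.

End SquareRoots.

Section SpectralProjections.
Context {R : realType} {H : completeNormedModType R[i]}.
Context {dot : {dot H for Num.conj}} (hd : hilbert dot).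
Context {M : set (H -> H)} (vM : vN_algebra dot M) (M1 : M idfun).
Implicit Types (x y z a b c p q E : H -> H) (h k u v : H).

Lemma sa_sqr_eq0 b h : is_adjoint dot b b -> b (b h) = 0 -> b h = 0.
Proof.
move=> sb bb; apply/eqP; rewrite -(dnorm_eq0 dot); apply/eqP.
by rewrite sb bb dot0r.
Qed.

(* [y = |a|], [b = (|a| + a) / 2] and [c = (|a| - a) / 2] satisfy [b c = 0];
   [E] projects onto the kernel of [b], which contains the range of [c]. *)
Lemma spectral_split a : M a -> is_adjoint dot a a -> (forall h, `|a h| <= `|h|) ->
  exists E, [/\ projections dot M E, forall h, dot (a (E h)) (E h) <= 0,
    forall h, E h = 0 -> 0 <= dot (a h) h &
    forall x, bounded_op x -> (forall h, x (a h) = a (x h)) ->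
      forall h, x (E h) = E (x h)].
Proof.
move=> Ma sa a1; have [y [My sy y0 yy yC]] := sqrt_sqr hd vM M1 Ma sa a1.
have la := vN_linear vM Ma; have ly := vN_linear vM My.
have ay h : a (y h) = y (a h) by apply: yC => //; exact: (vN_bounded vM Ma).
have i2 : 0 <= 2^-1 :> R[i] by rewrite invr_ge0.
have y1 h : `|y h| <= `|h|.
  apply: le_trans (a1 h); rewrite -(ler_pXn2r (n := 2)) ?nnegrE // -!(dot_norm hd).
  by rewrite sy yy -sa.
pose b h : H := 2^-1 *: (y h + a h).
pose c h : H := 2^-1 *: (y h - a h).
have Mb : M b by exact/(vNZ vM)/(vND vM).
have Mc : M c by exact/(vNZ vM)/(vNB vM).
have lb := vN_linear vM Mb; have lc := vN_linear vM Mc.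
have sb : is_adjoint dot b b.
  by move=> h k; rewrite dotZl dotZr dotDl dotDr sy sa (geC0_conj i2).
have b1 h : `|b h| <= `|h|.
  rewrite /b normrZ (ger0_norm i2) ler_pdivrMl // mulr_natl mulr2n.
  by apply: le_trans (ler_normD _ _) _; rewrite lerD.
have bc h : b (c h) = 0.
  rewrite /b /c (linZ _ _ ly) (linZ _ _ la) (linB _ _ ly) (linB _ _ la) ay yy.
  by rewrite -scalerDr addrA subrK subrr !scaler0.
have cb h : c (b h) = 0.
  rewrite /b /c (linZ _ _ ly) (linZ _ _ la) (linD _ _ ly) (linD _ _ la) ay yy.
  by rewrite -scalerBr [y (a h) + _]addrC subrr !scaler0.
(* The kernel of [b] is reached as the space of fixed vectors of [f^2], where [f = 1 - b^2]. *)
have [sf f1] := sa_contraction_1sub hd sb b1.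
set f := (fun h => h - b (b h)) in sf f1.
have Mf : M f by exact: (vNB vM M1 (vNM vM Mb Mb)).
have [E PE [Efix ffE EC]] := ker_projection hd vM M1 Mf sf f1.
have bE h : b (E h) = 0.
  apply: sa_sqr_eq0 => //; set w := b (b (E h)).
  (* Expanding [(1 - b^2)^2] on a fixed vector gives [2 b^2 = b^4] there. Since [b] is a
     contraction, [2 w = b^2 w] leaves only [w = 0]. *)
  have ww : w *+ 2 = b (b w).
    have := ffE h; rewrite /f -/w !(linB _ _ lb) -/w opprB -addrA.
    rewrite [- w + _]addrCA -opprD -[X in _ = X]addr0 => /addrI/eqP.
    by rewrite subr_eq0 -mulr2n eq_sym => /eqP.
  have : `|w *+ 2| <= `|w| by rewrite ww; apply: le_trans (b1 _) (b1 _).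
  rewrite normrMn mulr2n -subr_ge0 opprD addrA subrr sub0r oppr_ge0.
  by rewrite normr_le0 => /eqP.
exists E; split=> //.
- move=> h; have : b (E h) = 0 by exact: bE.
  move/eqP; rewrite scaler_eq0 invr_eq0 pnatr_eq0 /= addrC addr_eq0 => /eqP ->.
  by rewrite -scaleN1r dotZl mulN1r oppr_le0.
(* As [b c = 0], [E] fixes [c h]; as [E] commutes with [c], [c h = c (E h) = 0]. Hence [a h = y h],
   and [y] is positive. *)
- move=> h Eh0; have cE : E (c h) = c h.
    by apply: Efix; rewrite {2}/f bc (lin0 lb) subr0 /f bc (lin0 lb) subr0.
  have cf k : c (f k) = f (c k).
    rewrite /f bc (lin0 lb) subr0 (linB _ _ lc).
    by rewrite cb subr0.
  have : c h = 0 by rewrite -cE -EC ?Eh0 ?(lin0 lc) //; exact: (vN_bounded vM Mc).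
  move/eqP; rewrite scaler_eq0 invr_eq0 pnatr_eq0 /= subr_eq0 => /eqP <-.
  exact: y0.
- move=> x bx xa h; apply: EC => // {}h; have lx := bx.1.
  have xb k : x (b k) = b (x k).
    by rewrite /b (linZ _ _ lx) (linD _ _ lx) xa yC.
  by rewrite /f (linB _ _ lx) !xb.
Qed.

End SpectralProjections.

(** * Compressions by minimal projections *)

Section MinimalProjections.
Context {R : realType} {H : completeNormedModType R[i]}.
Context {dot : {dot H for Num.conj}} (hd : hilbert dot).
Context {M : set (H -> H)} (vM : vN_algebra dot M) (M1 : M idfun).
Implicit Types (x y z a b c p q : H -> H) (h k u v : H).

(** Evaluating the form at [h + x h] leaves twice the square norm of [x h]. *)
Lemma sa_quad_eq0 x : linear x -> is_adjoint dot x x ->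
  (forall h, dot (x h) h = 0) -> forall h, x h = 0.
Proof.
move=> lx sx x0 h; have := x0 (h + x h).
rewrite (linD _ _ lx) dotDl !dotDr !x0 add0r addr0 [dot (x (x h)) h]sx.
by move=> /eqP; rewrite -mulr2n mulrn_eq0 /= dnorm_eq0 => /eqP.
Qed.

Lemma proj_comp p q : projections dot M p -> projections dot M q ->
  (forall h, p (q h) = q (p h)) -> projections dot M (p \o q).
Proof.
move=> [Mp sp pp] [Mq sq qq] pq; split; first exact: (vNM vM).
  by move=> h k /=; rewrite sp sq pq.
apply/funext => h /=; rewrite -pq -[p (p _)]/((p \o p) _) pp.
by rewrite -[q (q _)]/((q \o q) _) qq.
Qed.

Lemma proj_idem p h : projections dot M p -> p (p h) = p h.
Proof. by case=> _ _ pp; rewrite -[LHS]/((p \o p) h) pp. Qed.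

Lemma proj_norm p h : projections dot M p -> dot (p h) h = `|p h| ^+ 2.
Proof. by move=> Pp; have [_ sp _] := Pp; rewrite -(dot_norm hd) !sp proj_idem. Qed.

(** The spectral projection [E] of [a - t] commutes with [p], so [p \o E] is a subprojection of [p].
    By minimality it is [0] or [p], so [a - t] has a constant sign on the range of [p]. *)
Lemma minimal_dichotomy p a (t : R) : projections dot M p ->
  (forall q, projections dot M q -> p \o q = q -> q = 0 \/ q = p) ->
  M a -> is_adjoint dot a a -> (forall h, a (p h) = p (a h)) ->
  (forall h, dot (a (p h)) (p h) <= t%:C%C * `|p h| ^+ 2) \/
  (forall h, t%:C%C * `|p h| ^+ 2 <= dot (a (p h)) (p h)).
Proof.
move=> Pp pmin Ma sa ap; have [Mp sp pp] := Pp; have lp := vN_linear vM Mp.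
have Mt : M (fun h => a h - t%:C%C *: h) by exact: (vNB vM Ma (vNZ vM _ M1)).
(* Dividing [a - t] by a positive bound makes it a contraction, as [spectral_split] demands, without
   changing signs. *)
have [K K0 aK] := bounded_op_le (vN_bounded vM Mt).
have tr : (t%:C%C : R[i])^* = t%:C%C by apply/CrealP/complex_realP; exists t.
have Kr : (K^-1)^* = K^-1 by rewrite geC0_conj // invr_ge0 ltW.
pose a' h : H := K^-1 *: (a h - t%:C%C *: h).
have Ma' : M a' by exact: (vNZ vM).
have [||E [PE E0 E1 EC]] := spectral_split hd vM M1 Ma'.
- by move=> h k; rewrite dotZl dotZr dotBl dotBr dotZl dotZr sa Kr tr.
- move=> h; rewrite normrZ ger0_norm ?invr_ge0 ?(ltW K0) //.
  by rewrite ler_pdivrMl.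
have a'E h : dot (a' (p h)) (p h) =
    K^-1 * (dot (a (p h)) (p h) - t%:C%C * `|p h| ^+ 2).
  by rewrite dotZl dotBl dotZl (dot_norm hd).
have pE h : p (E h) = E (p h).
  apply: EC; first exact: (vN_bounded vM Mp).
  by move=> k; rewrite /a' (linZ _ _ lp) (linB _ _ lp) (linZ _ _ lp) ap.
have [pE0|pEp] := pmin _ (proj_comp Pp PE pE) (funext (fun h => proj_idem (E h) Pp)).
  right=> h; have : E (p h) = 0 by rewrite -pE -[LHS]/((p \o E) h) pE0.
  by move/E1; rewrite a'E pmulr_rge0 ?invr_gt0 // subr_ge0.
left=> h; have : E (p h) = p h by rewrite -pE -[LHS]/((p \o E) h) pEp.
have := E0 (p h) => + Ep; rewrite Ep a'E pmulr_rle0 ?invr_gt0 // subr_le0; exact.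
Qed.

Lemma minimal_sa_scalar p a : projections dot M p -> p <> 0 ->
  (forall q, projections dot M q -> p \o q = q -> q = 0 \/ q = p) ->
  M a -> is_adjoint dot a a -> exists t : R[i], forall h, p (a (p h)) = t *: p h.
Proof.
move=> Pp p0 pmin Ma sa; have [Mp sp pp] := Pp; have lp := vN_linear vM Mp.
pose b h := p (a (p h)).
have Mb : M b by exact: (vNM vM Mp (vNM vM Ma Mp)).
have sb : is_adjoint dot b b by move=> h k; rewrite /b sp sa sp.
have bp h : b (p h) = p (b h) by rewrite /b !(proj_idem _ Pp).
have dich t := minimal_dichotomy t Pp pmin Mb sb bp.
have [K K0 bK] := bounded_op_le (vN_bounded vM Mb).
have Kr : K = (complex.Re K)%:C%C by rewrite RRe_real // gtr0_real.
have bbnd h : `|dot (b (p h)) (p h)| <= K * `|p h| ^+ 2.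
  apply: le_trans (CauchySchwarz_dot hd _ _) _.
  by rewrite expr2 mulrA ler_wpM2r.
(* A vector with [p k] nonzero is what bounds the set [S] below from above. *)
have [k pk0] : exists k, p k != 0.
  apply: contrapT => nex; apply: p0; apply/funext => h; apply/eqP.
  by apply/negPn/negP => ph; apply: nex; exists h.
have pk1 : 0 < `|p k| ^+ 2 by rewrite exprn_gt0 // normr_gt0.
have dr h : dot (b (p h)) (p h) \is Num.real by exact: dot_sa_real.
(* The scalar is found as a cut: reals in [S] lie below the form of [b] on the range of [p], and by
   the dichotomy those beyond its supremum lie above it. *)
pose S := [set t : R | forall h, t%:C%C * `|p h| ^+ 2 <= dot (b (p h)) (p h)].
have Ssup : has_sup S.
  split.
    exists (- complex.Re K) => h; rewrite rmorphN /= -Kr mulNr.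
    by have := bbnd h; rewrite real_ler_norml // => /andP[].
  exists (complex.Re K) => t /(_ k) tk; rewrite -lecR -Kr -(ler_pM2r pk1).
  by apply: le_trans tk _; apply: le_trans (real_ler_norm (dr _)) _.
exists (sup S)%:C%C.
have quad h : dot (b (p h)) (p h) = (sup S)%:C%C * `|p h| ^+ 2.
  have ph2 : (`|p h| ^+ 2) = (complex.Re (`|p h| ^+ 2))%:C%C.
    by rewrite RRe_real // ger0_real // exprn_ge0.
  have dE : dot (b (p h)) (p h) = (complex.Re (dot (b (p h)) (p h)))%:C%C.
    by rewrite RRe_real.
  move: ph2 dE; set n := complex.Re _; set d := complex.Re _ => nE dE.
  have n0 : 0 <= n by rewrite -ler0c -nE exprn_ge0.
  have lo t : S t -> t * n <= d.
    by move=> /(_ h); rewrite dE nE -rmorphM lecR.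
  have hi t : sup S < t -> d <= t * n.
    move=> St; have [/(_ h)|tS] := dich t; first by rewrite dE nE -rmorphM lecR.
    by have := ub_le_sup Ssup.2 tS; rewrite leNgt St.
  rewrite dE nE -rmorphM; congr (_%:C%C); apply/eqP; rewrite eq_le.
  (* Since [n] may be zero, the margin is [e / (n + 1)]; multiplied by [n] it stays at most [e]. *)
  apply/andP; split; apply/ler_addgt0Pr => e e0; have e1 : 0 < e / (n + 1).
  - by rewrite divr_gt0 // ltr_wpDl.
  - have /hi : sup S < sup S + e / (n + 1) by rewrite ltrDl.
    move/le_trans; apply; rewrite mulrDl lerD2l.
    rewrite mulrAC ler_pdivrMr ?ltr_wpDl // ler_wpM2l ?(ltW e0) //.
    by rewrite lerDl.
  - by rewrite divr_gt0 // ltr_wpDl.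
  - have [t /lo tn St] := sup_adherent e1 Ssup.
    rewrite -lerBlDr; apply: le_trans tn; rewrite lerBlDr.
    apply: (@le_trans _ _ ((t + e / (n + 1)) * n)).
      by rewrite ler_wpM2r // -lerBlDr ltW.
    rewrite mulrDl lerD2l mulrAC ler_pdivrMr ?ltr_wpDl // ler_wpM2l ?(ltW e0) //.
    by rewrite lerDl.
move=> h; set s := (sup S)%:C%C in quad *.
have sr : s^* = s by apply/CrealP/complex_realP; exists (sup S).
apply/eqP; rewrite -subr_eq0; apply/eqP.
apply: (@sa_quad_eq0 (fun h => b h - s *: p h)).
- exact: (vN_linear vM (vNB vM Mb (vNZ vM _ Mp))).
- by move=> u v; rewrite dotBl dotBr dotZl dotZr sb sp sr.
- move=> u; rewrite dotBl dotZl (proj_norm _ Pp) -quad.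
  by rewrite {2}/b (proj_idem _ Pp) -sp /b !(proj_idem _ Pp) subrr.
Qed.

Lemma proper_subprojection p : projections dot M p -> p <> 0 ->
  (forall p, projections dot M p -> abelian_projection M p -> p = 0) ->
  exists q, [/\ projections dot M q, p \o q = q, q <> 0 & q <> p].
Proof.
move=> Pp p0 nab; apply: contrapT => nex; apply: p0; apply: nab => //.
have [Mp sp pp] := Pp; have lp := vN_linear vM Mp.
have pmin q : projections dot M q -> p \o q = q -> q = 0 \/ q = p.
  move=> Pq pq; apply: contrapT => /not_orP[q0 qp]; apply: nex.
  by exists q; split.
have [->|p0] := pselect (p = 0).
  by move=> x y Mx My; apply/funext.
suff sc x : M x -> exists t : R[i], forall h, p (x (p h)) = t *: p h.
  move=> x y /sc[s xs] /sc[t yt]; apply/funext => h /=.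
  by rewrite !xs !yt !(linZ _ _ lp) !(proj_idem _ Pp) !scalerA mulrC.
move=> Mx; have [x' Mx' xx'] := vN_adj vM Mx; have x'x := is_adjoint_sym xx'.
have [|s ss] := minimal_sa_scalar Pp p0 pmin (vND vM Mx Mx').
  by move=> h k; rewrite dotDl dotDr xx' x'x addrC.
have [|t tt] := minimal_sa_scalar Pp p0 pmin (vNZ vM 'i (vNB vM Mx Mx')).
  move=> h k; rewrite dotZl dotZr dotBl dotBr xx' x'x conjCi.
  by rewrite mulNr -mulrN opprB.
(* Here [s] is the scalar of [x + x'] and [t] that of ['i (x - x')], and
   [2 x = (x + x') - 'i ('i (x - x'))]. *)
exists (2^-1 * (s - 'i * t)) => h.
rewrite -scalerA scalerBl -scalerA -ss -tt -!(linZ _ _ lp) -(linB _ _ lp).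
rewrite -(linZ _ _ lp); congr (p _); move: (x (p h)) (x' (p h)) => u v.
rewrite scalerA -expr2 sqrCi scaleN1r opprK addrACA subrr addr0 -mulr2n.
by rewrite -[u *+ 2]scaler_nat scalerA mulVf ?scale1r // pnatr_eq0.
Qed.

End MinimalProjections.

(** * Fine partitions *)

Definition trace_re {R : realType} {H : completeNormedModType R[i]}
  (tau : (H -> H) -> R[i]) (p : H -> H) : R := complex.Re (tau p).

Section Trace.
Context {R : realType} {H : completeNormedModType R[i]}.
Context {dot : {dot H for Num.conj}} (hd : hilbert dot).
Context {M : set (H -> H)} (hM : II1_factor dot M).
Context {tau : (H -> H) -> R[i]} (ht : faithful_normal_trace dot M tau).
Implicit Types (x y z p q r : H -> H) (h k u v : H).

Let vM : vN_algebra dot M. Proof. by case: hM => -[]. Qed.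
Let M1 : M idfun. Proof. by case: hM => -[]. Qed.

Local Notation tr := (trace_re tau).

Lemma tauP (s : R[i]) x y : M x -> M y -> tau (s *: x + y) = s * tau x + tau y.
Proof. by case: ht => -[+ _ _ _] _; exact. Qed.

Lemma tau0 : tau 0 = 0.
Proof.
by have := tauP (-1) (vN0 vM) (vN0 vM); rewrite scaler0 addr0 mulN1r addNr.
Qed.

Lemma tauD x y : M x -> M y -> tau (x + y) = tau x + tau y.
Proof. by move=> Mx My; have := tauP 1 Mx My; rewrite scale1r mul1r. Qed.

Lemma tauB x y : M x -> M y -> tau (x - y) = tau x - tau y.
Proof.
by move=> Mx My; have := tauP (-1) My Mx; rewrite scaleN1r mulN1r !(addrC (- _)).
Qed.

Lemma tau_ge0 p : projections dot M p -> 0 <= tau p.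
Proof.
move=> [Mp sp pp]; case: ht => -[_ + _ _] _ => /(_ p p Mp Mp sp).
by rewrite pp.
Qed.

Lemma tau_tr p : projections dot M p -> tau p = (tr p)%:C%C.
Proof. by move=> Pp; rewrite RRe_real // ger0_real // tau_ge0. Qed.

Lemma tr_ge0 p : projections dot M p -> 0 <= tr p.
Proof. by move=> Pp; rewrite -ler0c -tau_tr // tau_ge0. Qed.

Lemma tr_gt0 p : projections dot M p -> p <> 0 -> 0 < tr p.
Proof.
move=> Pp p0; rewrite lt_neqAle tr_ge0 // andbT eq_sym; apply/eqP => tp.
apply: p0; have [Mp sp pp] := Pp; case: ht => _ [+ _] => /(_ p p Mp Mp sp).
by apply; rewrite pp tau_tr // tp.
Qed.

Lemma tr0 : tr 0 = 0.
Proof. by rewrite /trace_re tau0. Qed.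

Lemma tr1 : tr idfun = 1.
Proof. by rewrite /trace_re; case: ht => -[_ _ _ ->]. Qed.

Lemma proj0 : projections dot M 0.
Proof.
split; first exact: (vN0 vM).
- by move=> h k; rewrite dot0l dot0r.
- by apply/funext.
Qed.

Lemma subprojC p q : projections dot M p -> projections dot M q ->
  p \o q = q -> q \o p = q.
Proof.
move=> [_ sp _] [_ sq _] pq; apply/funext => h; apply: (@dot_ext _ _ dot) => k /=.
by rewrite !sq sp -[p (q k)]/((p \o q) k) pq.
Qed.

Lemma projB p q : projections dot M p -> projections dot M q ->
  p \o q = q -> projections dot M (p - q).
Proof.
move=> Pp Pq pq; have qp := subprojC Pp Pq pq.
have [[Mp sp pp] [Mq sq qq]] := (Pp, Pq).
have lp := vN_linear vM Mp; have lq := vN_linear vM Mq.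
split; first exact: (vNB vM Mp Mq).
  by move=> h k; rewrite -[(p - q) h]/(p h - q h) -[(p - q) k]/(p k - q k)
    dotBl dotBr sp sq.
apply/funext => h; rewrite -[LHS]/(p (p h - q h) - q (p h - q h)).
rewrite (linB _ _ lp) (linB _ _ lq) (proj_idem _ Pp) (proj_idem _ Pq).
rewrite -[p (q h)]/((p \o q) h) -[q (p h)]/((q \o p) h) pq qp.
by rewrite subrr subr0.
Qed.

Lemma trB p q : projections dot M p -> projections dot M q ->
  tr (p - q) = tr p - tr q.
Proof. by move=> [Mp _ _] [Mq _ _]; rewrite /trace_re tauB // raddfB. Qed.

Lemma subprojB p q : projections dot M p -> projections dot M q ->
  p \o q = q -> p \o (p - q) = p - q.
Proof.
move=> Pp Pq pq; apply/funext => h; have [Mp _ _] := Pp.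
rewrite -[LHS]/(p (p h - q h)) (linB _ _ (vN_linear vM Mp)) (proj_idem _ Pp).
by rewrite -[p (q h)]/((p \o q) h) pq.
Qed.

(** A proper nonzero subprojection and its complement in [p] share the trace of [p], so one of them
    has at most half of it. *)
Lemma half_subprojection p : projections dot M p -> p <> 0 ->
  exists q, [/\ projections dot M q, p \o q = q, q <> 0 & tr q <= tr p / 2].
Proof.
move=> Pp p0; have [_ _ nab] := hM.
have [q [Pq pq q0 qp]] := proper_subprojection hd vM M1 Pp p0 nab.
have [qle|qgt] := leP (tr q) (tr p / 2); first by exists q.
exists (p - q); split; [exact: projB|exact: subprojB| |].
  by move=> /eqP; rewrite subr_eq0 => /eqP/esym.
rewrite trB //; lra.
Qed.

Lemma small_subprojection p (e : R) : projections dot M p -> p <> 0 -> 0 < e ->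
  exists q, [/\ projections dot M q, p \o q = q, q <> 0 & tr q <= e].
Proof.
move=> Pp p0 e0.
have hlf n : exists q, [/\ projections dot M q, p \o q = q, q <> 0 &
    tr q <= tr p / (2 ^ n)%:R].
  elim: n => [|n [q [Pq pq q0 qn]]].
    by exists p; split=> //; [case: Pp|rewrite divr1].
  have [r [Pr qr r0 rq]] := half_subprojection Pq q0.
  exists r; split=> //; first by rewrite -qr compA pq.
  apply: (le_trans rq); rewrite expnSr natrM invfM mulrA.
  by rewrite ler_wpM2r.
(* This number of halvings suffices because [2 ^ n] exceeds [n]. *)
have [q [Pq pq q0 qe]] := hlf (Num.bound (tr p / e)).
exists q; split=> //; apply: le_trans qe _.
rewrite ler_pdivrMr ?ltr0n ?expn_gt0 // mulrC -ler_pdivrMr //.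
apply: le_trans (ltW (archi_boundP _)) _; first by rewrite divr_ge0 ?tr_ge0 // ltW.
by rewrite ler_nat ltnW // ltn_expl.
Qed.

Lemma proj_contraction p h : projections dot M p -> `|p h| <= `|h|.
Proof.
move=> Pp; have [->|ph0] := eqVneq (p h) 0; first by rewrite normr0.
have ph : 0 < `|p h| by rewrite normr_gt0.
rewrite -(ler_pM2l ph) -expr2 -(proj_norm hd _ Pp).
apply: le_trans (real_ler_norm _) (CauchySchwarz_dot hd _ _).
by rewrite (proj_norm hd _ Pp) ger0_real // exprn_ge0.
Qed.

(** The projections converge strongly to a projection below all of them. Strong convergence alone
    says nothing about [tau]; the bound on the trace comes from normality. *)
Lemma decreasing_proj_limit (r : nat -> H -> H) (e : R) :
  (forall n, projections dot M (r n)) ->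
  (forall m n, (m <= n)%N -> r m \o r n = r n) -> (forall n, e <= tr (r n)) ->
  exists s, [/\ projections dot M s, forall n, r n \o s = s & e <= tr s].
Proof.
move=> Pr rr re.
have rrE m n h : (m <= n)%N -> r m (r n h) = r n h.
  by move=> mn; rewrite -[LHS]/((r m \o r n) h) rr.
have sr n : is_adjoint dot (r n) (r n) by case: (Pr n).
have rrE' m n h : (m <= n)%N -> r n (r m h) = r n h.
  by move=> mn; apply: (@dot_ext _ _ dot) => k; rewrite !sr rrE.
pose g h n : R := complex.Re (`|r n h| ^+ 2).
have gE h n : `|r n h| ^+ 2 = (g h n)%:C%C.
  by rewrite RRe_real // ger0_real // exprn_ge0.
have [||||s Ms Ts] := @op_limit _ _ _ hd M r g vM.
- by move=> n; case: (Pr n).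
- by move=> n h; exact: proj_contraction.
- by move=> h n; rewrite -ler0c -gE exprn_ge0.
- move=> h m n mn; rewrite -(dot_norm hd) dotBl !dotBr rmorphB /= -!gE.
  have -> : dot (r m h) (r n h) = `|r n h| ^+ 2.
    by rewrite sr rrE // -(sr n) (proj_norm hd _ (Pr n)).
  have -> : dot (r n h) (r m h) = `|r n h| ^+ 2.
    by rewrite sr rrE' // -(sr n) (proj_norm hd _ (Pr n)).
  by rewrite !(dot_norm hd) subrr subr0.
have ss : is_adjoint dot s s by exact: lim_sa Ts.
have rs n h : r n (s h) = s h.
  have [Mrn _ _] := Pr n; have [_ cr] := vN_bounded vM Mrn.
  have rT : (fun m => r n (r m h)) @ \oo --> r n (s h).
    by apply: continuous_cvg; [exact: cr|exact: Ts].
  apply: (cvg_seq_unique rT); apply: cvg_trans (Ts h).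
  apply: near_eq_cvg; near=> m; rewrite rrE //.
  by near: m; exists n.
have Ps : projections dot M s.
  split=> //; apply/funext => h /=; apply: (cvg_seq_unique (Ts (s h))).
  under eq_fun do rewrite rs; exact: cvg_cst.
have sr' n h : s (r n h) = s h by apply: (@dot_ext _ _ dot) => k; rewrite ss sr rs.
exists s; split=> //; first by move=> n; apply/funext => h /=.
have [Mr1 Ms1] : (forall n, M (r n)) * M s by split=> // n; case: (Pr n).
(* Normality is stated for suprema, so it is applied to the complements, which increase to
   [idfun - s]. *)
pose D := [set x | exists n, x = (idfun : H -> H) - r n].
have DP n : projections dot M ((idfun : H -> H) - r n) by apply: projB.
have s1 : projections dot M ((idfun : H -> H) - s) by apply: projB.
have ope x y : op_le dot y x -> op_le dot ((idfun : H -> H) - x) ((idfun : H -> H) - y).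
  move=> xy h; rewrite -[X in dot X _ <= _]/(h - x h) -[X in _ <= dot X _]/(h - y h).
  by rewrite !dotBl lerD2l lerN2; exact: xy.
have [|||_ lubs] := ht.2.2 D (idfun - s).
- by move=> _ [n ->]; have [] := DP n; split.
- split; first by exists (idfun - r 0%N), 0%N.
  move=> _ _ [m ->] [n ->]; exists (idfun - r (maxn m n)); split.
  + by exists (maxn m n).
  + apply: ope => h; rewrite !(proj_norm hd _ (Pr _)) ler_pXn2r ?nnegrE //.
    by rewrite -(@rrE' m (maxn m n)) ?leq_maxl // proj_contraction.
  + apply: ope => h; rewrite !(proj_norm hd _ (Pr _)) ler_pXn2r ?nnegrE //.
    by rewrite -(@rrE' n (maxn m n)) ?leq_maxr // proj_contraction.
- split; first by have [] := s1; split.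
  + move=> _ [n ->]; apply: ope => h.
    rewrite (proj_norm hd _ Ps) (proj_norm hd _ (Pr n)) ler_pXn2r ?nnegrE //.
    by rewrite -(@sr' n) proj_contraction.
  (* For the least upper bound, the inequality with [idfun - r n] is passed to the limit at each
     vector. *)
  + move=> y [My sy] Dy h; rewrite -subr_ge0.
    apply: (@seq_lim_ge0 _ (fun n => dot (y h) h - dot (h - r n h) h)).
      apply: cvgB; first exact: cvg_cst.
      apply: cvg_dotl => //; apply: cvgB; first exact: cvg_cst.
      exact: Ts.
    by move=> n; rewrite subr_ge0; apply: (Dy (idfun - r n)); exists n.
have : tau (idfun - s) <= (1 - e)%:C%C.
  apply: lubs => _ [_ [n ->] <-]; rewrite tau_tr // lecR trB //.
  by rewrite tr1 lerD2l lerN2.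
rewrite tau_tr // lecR trB //.
by rewrite tr1 lerD2l lerN2.
Unshelve. all: by end_near. Qed.

End Trace.

(** * Splitting projections and refining partitions *)

Section Refinement.
Context {R : realType} {H : completeNormedModType R[i]}.
Context {dot : {dot H for Num.conj}} (hd : hilbert dot).
Context {M : set (H -> H)} (hM : II1_factor dot M).
Context {tau : (H -> H) -> R[i]} (ht : faithful_normal_trace dot M tau).
Implicit Types (x y z p q r : H -> H) (h k u v : H) (s t : seq (H -> H)).

Let vM : vN_algebra dot M. Proof. by case: hM => -[]. Qed.
Let M1 : M idfun. Proof. by case: hM => -[]. Qed.
Local Notation tr := (trace_re tau).

(** Any admissible subprojection whose trace exceeds half the supremum will do, so attainment of the
    supremum is not at issue. *)
Lemma big_subprojection r (e : R) : 0 < e -> projections dot M r ->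
  exists q, [/\ projections dot M q, r \o q = q, tr q <= e &
    forall q', projections dot M q' -> r \o q' = q' -> tr q' <= e ->
      tr q' <= 2 * tr q].
Proof.
move=> e0 Pr; have [Mr _ _] := Pr.
pose S := [set tr q | q in [set q | [/\ projections dot M q, r \o q = q & tr q <= e]]].
have r0 : r \o (0 : H -> H) = (0 : H -> H).
  apply/funext => h; exact: (lin0 (vN_linear vM Mr)).
have S0 : S 0.
  exists 0; last exact: (tr0 hM ht).
  by split; [exact: (proj0 hM)|by []|rewrite (tr0 hM ht) ltW].
have Ssup : has_sup S by split; [exists 0|exists e => _ [q [_ _ qe] <-]].
have leS q' : projections dot M q' -> r \o q' = q' -> tr q' <= e -> tr q' <= sup S.
  by move=> ? ? ?; apply: (ub_le_sup Ssup.2); exists q'.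
have : 0 <= sup S by exact: (ub_le_sup Ssup.2).
(* When the supremum is zero, half of it is no strict margin, and [q = 0] is taken instead. *)
rewrite le_eqVlt => /orP[/eqP S0'|S1].
  exists 0; split; rewrite ?(tr0 hM ht) ?(ltW e0) //; first exact: (proj0 hM).
  by move=> q' Pq' rq' qe; rewrite mulr0 S0'; apply: leS.
have S2 : 0 < sup S / 2 by rewrite divr_gt0.
have [_ [q [Pq rq qe] <-] qS] := sup_adherent S2 Ssup.
exists q; split=> // q' Pq' rq' q'e; apply: le_trans (leS q' Pq' rq' q'e) _; lra.
Qed.

(** The list may contain [0], even repeatedly. Orthogonality is asked in list order only; adjoints
    give the other order. *)
Definition finely_split (e : R) p := exists s : seq (H -> H),
  [/\ forall q, q \in s -> [/\ projections dot M q, p \o q = q & tr q <= e],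
      pairwise (fun q r => q \o r == 0) s & \sum_(q <- s) q = p].

Lemma finely_split_step e p q : projections dot M p -> projections dot M q ->
  p \o q = q -> tr q <= e -> finely_split e (p - q) -> finely_split e p.
Proof.
move=> Pp Pq pq qe [s [sP sO sS]]; have qp := subprojC Pp Pq pq.
have [Mq _ _] := Pq.
have ppq := subprojB hM Pp Pq pq.
exists (q :: s); split; last by rewrite big_cons sS addrC subrK.
  move=> r; rewrite in_cons => /orP[/eqP -> //|/sP[Pr pqr re]]; split=> //.
  by rewrite -pqr compA ppq.
rewrite /= sO andbT; apply/allP => r /sP[Pr pqr _]; apply/eqP/funext => h.
rewrite -pqr -[LHS]/(q (p (r h) - q (r h))) (linB _ _ (vN_linear vM Mq)).
by rewrite (proj_idem _ Pq) -[q (p _)]/((q \o p) _) qp subrr.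
Qed.

(* Splits off greedily a subprojection of trace at most [e] that is maximal up
   to a factor 2. If the remainders kept trace above [e], so would their limit,
   by normality; small subprojections of the limit would then bound below the
   traces of all the pieces. *)
Lemma finely_split_proj p (e : R) : projections dot M p -> 0 < e -> finely_split e p.
Proof.
move=> Pp e0.
have /choice[Q QP] : forall r, exists q, projections dot M r ->
   [/\ projections dot M q, r \o q = q, tr q <= e &
    forall q', projections dot M q' -> r \o q' = q' -> tr q' <= e ->
      tr q' <= 2 * tr q].
  move=> r; have [/(big_subprojection e0)[q Pq]|nPr] := pselect (projections dot M r).
    by exists q.
  by exists 0.
pose r n := iter n (fun r => r - Q r) p.
have Pr n : projections dot M (r n).
  by elim: n => //= n IH; have [? ? _ _] := QP _ IH; exact: (projB hM).
have rr m n : (m <= n)%N -> r m \o r n = r n.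
  move=> mn; rewrite -(subnK mn); elim: (n - m)%N => [|k IH].
    by rewrite add0n; case: (Pr m).
  have [PQ rQ _ _] := QP _ (Pr (k + m)%N).
  by rewrite addSn /= -(subprojB hM (Pr (k + m)%N) PQ rQ) compA IH.
have [[n rn]|nre] := pselect (exists n, tr (r n) <= e).
  suff : finely_split e (r 0%N) by [].
  have : finely_split e (r n).
    exists [:: r n]; split=> //; last by rewrite big_seq1.
    by move=> q; rewrite mem_seq1 => /eqP ->; split=> //; case: (Pr n).
  (* Descending from [r n] to [r 0 = p], the removed pieces are put back one at a time. *)
  elim: n {rn} => // n IH fn; apply: IH; have [PQ rQ Qe _] := QP _ (Pr n).
  exact: (finely_split_step (Pr n) PQ rQ Qe fn).
have re n : e <= tr (r n).
  by apply/ltW; rewrite ltNge; apply/negP => rn; apply: nre; exists n.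
have [s [Ps rs es]] := decreasing_proj_limit hd hM ht Pr rr re.
have s0 : s <> 0 by move=> s0; move: es; rewrite s0 (tr0 hM ht) leNgt e0.
have [q [Pq sq q0 qe]] := small_subprojection hd hM ht Ps s0 e0.
have q1 := tr_gt0 ht Pq q0.
(* Lying below [s], [q] competes at every stage, so each piece [Q (r n)] has at least half its
   trace. The bound turns negative for large [n]. *)
have rn n : tr (r n) <= tr p - n%:R * (tr q / 2).
  elim: n => [|n IH]; first by rewrite mul0r subr0.
  have [PQ rQ _ Qm] := QP _ (Pr n).
  have : tr q <= 2 * tr (Q (r n)).
    by apply: Qm => //; rewrite -sq compA rs.
  rewrite [r n.+1]/(r n - Q (r n)) (trB ht (Pr n) PQ) -(natr1 n).
  move: IH; rewrite mulrDl mul1r.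
  lra.
have q2 : 0 < tr q / 2 by rewrite divr_gt0.
have := archi_boundP (divr_ge0 (tr_ge0 ht Pp) (ltW q2)).
rewrite ltr_pdivrMr // => pn.
have := le_trans (tr_ge0 ht (Pr _)) (rn (Num.bound (tr p / (tr q / 2)))).
by rewrite subr_ge0 leNgt pn.
Qed.

(** This is [I_elt] for a partition listed without repetition, as an iterated sum that can be split
    and reindexed. *)
Definition cost x s : R :=
  \sum_(p <- s) \sum_(q <- s) if p \o x \o q == 0 then 0 else tr p * tr q.

Lemma I_elt_cost x s : uniq s -> I_elt tau x [set` s] = cost x s.
Proof.
move=> us; rewrite /I_elt.
have -> : [set pq : (H -> H) * (H -> H) |
     [/\ [set` s] pq.1, [set` s] pq.2 & pq.1 \o x \o pq.2 <> 0]] =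
   ([set` s] `*` [set` s]) `&` [set pq : (H -> H) * (H -> H) | pq.1 \o x \o pq.2 <> 0].
  by apply/seteqP; split=> pq /=; [move=> []|move=> [[]]].
rewrite fsbig_mkcondr -(@pair_fsbig _ _ _ _ _ _ _
  (fun p q => if (p, q) \in [set pq : (H -> H) * (H -> H) |
    pq.1 \o x \o pq.2 <> 0] then tr p * tr q else 0)) //.
rewrite /cost [RHS]fsbig_seq //; apply: eq_fsbigr => p _.
rewrite [RHS]fsbig_seq //; apply: eq_fsbigr => q _.
by case: eqP => e; [rewrite memNset // => /(_ e)|rewrite mem_set].
all: exact: finite_seq.
Qed.

Lemma big_filter_neq0 (V : nmodType) (l : seq (H -> H)) (f : (H -> H) -> V) :
  f 0 = 0 -> \sum_(p <- [seq q <- l | q != 0]) f p = \sum_(p <- l) f p.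
Proof.
move=> f0; rewrite big_filter big_mkcond; apply: eq_bigr => p _.
by case: eqP => // ->.
Qed.

Lemma tr_sum p s : (forall q, q \in s -> projections dot M q) ->
  \sum_(q <- s) q = p -> \sum_(q <- s) tr q = tr p.
Proof.
move=> sP <-; suff [] : \sum_(q <- s) tr q = tr (\sum_(q <- s) q) /\
  M (\sum_(q <- s) q) by [].
elim: s sP => [|q s IH] sP.
  by rewrite !big_nil (tr0 hM ht); split=> //; exact: (vN0 vM).
rewrite !big_cons; have [|-> Ms] := IH.
  by move=> r rs; apply: sP; rewrite in_cons rs orbT.
have [Mq _ _] : projections dot M q by apply: sP; rewrite mem_head.
split; last exact: (vND vM).
by rewrite /trace_re (tauD ht) // raddfD.
Qed.

(** Each [p] is replaced by a fine splitting. A vanishing corner [p x q] has only vanishing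
    subcorners, and for any other one the products of traces over the subcorners add up to at most
    [tr p * tr q]. *)
Lemma fine_refinement P (e : R) : projection_partitions dot M P -> 0 < e ->
  exists t, [/\ uniq t,
    forall p, p \in t -> projections dot M p /\ tr p <= e,
    forall p q, p \in t -> q \in t -> p <> q -> p \o q = 0,
    \sum_(p <- t) p = idfun &
    forall x, M x -> cost x t <= I_elt tau x P].
Proof.
move=> [finP PM PO PS] e0; pose s : seq (H -> H) := finmap.enum_fset (fset_set P).
have us : uniq s by exact: finmap.fset_uniq.
have sP : P = [set` s] by rewrite -{1}(fset_setK finP).
have Ps p : p \in s -> projections dot M p by move=> ps; apply: PM; rewrite sP.
have /choice[F FP] : forall p, exists l : seq (H -> H), p \in s ->
  [/\ forall q, q \in l -> [/\ projections dot M q, p \o q = q & tr q <= e],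
      pairwise (fun q r => q \o r == 0) l & \sum_(q <- l) q = p].
  move=> p; have [/Ps Pp|ps] := boolP (p \in s); last by exists nil.
  by have [l lP] := finely_split_proj Pp e0; exists l.
pose t0 := flatten (map F s); pose t := [seq q <- t0 | q != 0].
have t0P q : q \in t0 -> projections dot M q /\ tr q <= e.
  by move=> /flatten_mapP[p ps qp]; have [/(_ q qp)[]] := FP p ps.
have tO : pairwise (fun q r => q \o r == 0) t.
  apply: pairwise_filter; rewrite /t0.
  have : {subset s <= s} by [].
  elim: {1 2 4}s us => //= p l IH /andP[pl ul] pls.
  rewrite pairwise_cat IH //; last by move=> q ql; apply: pls; rewrite in_cons ql orbT.
  have ps : p \in s by apply: pls; rewrite mem_head.
  have [Fp -> _] := FP p ps; rewrite !andbT.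
  apply/allrelP => q r /Fp[Pq pq _] /flatten_mapP[p' p'l rp'].
  have p's : p' \in s by apply: pls; rewrite in_cons p'l orbT.
  have [/(_ _ rp')[Pr p'r _] _ _] := FP p' p's.
  have qp := subprojC (Ps _ ps) Pq pq; have [Mq _ _] := Pq.
  (* Pieces of different blocks are orthogonal because [q r = q p p' r] and [p p' = 0]. *)
  rewrite -qp -p'r -[_ \o _]/(q \o (p \o p') \o r) PO ?sP //; last first.
    by move=> pp'; rewrite pp' p'l in pl.
  by apply/eqP/funext => h; exact: (lin0 (vN_linear vM Mq)).
have tP q : q \in t -> projections dot M q /\ tr q <= e.
  by rewrite mem_filter => /andP[_ /t0P].
have t0neq q : q \in t -> q != 0 by rewrite mem_filter => /andP[].
have ut : uniq t.
  (* A repeated entry would be orthogonal to itself, hence zero, and zeros have been filtered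
     out. *)
  rewrite uniq_pairwise; move: tO; apply: (@sub_in_pairwise _ (mem t)); last exact/allP.
  move=> q r qt rt /eqP qr.
  apply: contraTN (t0neq r rt) => /eqP qr'; rewrite negbK; apply/eqP.
  by rewrite -qr qr'; have [[]] := tP r rt.
exists t; split=> //.
- move=> p q pt qt pq; have [[Pp _] [Pq _]] := (tP p pt, tP q qt).
  have [Mp sp _] := Pp; have [Mq sq _] := Pq.
  have [m n] : (index p t < size t)%N * (index q t < size t)%N.
    by rewrite !index_mem.
  move: tO => /(pairwiseP (0 : H -> H)).
  have [ij|ij|ij] := ltngtP (index p t) (index q t).
  + by move=> /(_ _ _ m n ij); rewrite !nth_index // => /eqP.
  + move=> /(_ _ _ n m ij); rewrite !nth_index // => /eqP qp0.
    apply/funext => h; apply: (@dot_ext _ _ dot) => k /=.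
    by rewrite sp sq -[q (p k)]/((q \o p) k) qp0 dot0l dot0r.
  + by move=> _; case: pq; rewrite -(nth_index 0 pt) ij nth_index.
- rewrite big_filter_neq0 //.
  rewrite /t0 big_flatten big_map -PS sP -fsbig_seq //.
  by apply: eq_big_seq => p /FP[].
- move=> x Mx; rewrite sP I_elt_cost // /cost.
  have tr00 := tr0 hM ht.
  pose f p q : R := if p \o x \o q == 0 then 0 else tr p * tr q.
  (* The discarded zeros have trace zero, so both sums may run over the unfiltered list, which is
     grouped in blocks. *)
  rewrite (@big_filter_neq0 _ t0 (fun p => \sum_(q <- t) f p q)); last first.
    by apply: big1 => q _; rewrite /f tr00 mul0r if_same.
  under eq_bigr => p _.
    rewrite (@big_filter_neq0 _ t0 (f p)); last by rewrite /f tr00 mulr0 if_same.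
    over.
  rewrite /t0 big_flatten big_map; apply: ler_sum_seq => p ps.
  under eq_bigr => p' _ do rewrite big_flatten big_map.
  rewrite exchange_big; apply: ler_sum_seq => q qs /=.
  have [Fp _ Sp] := FP p ps; have [Fq _ Sq] := FP q qs.
  have [p0|pq0] := eqVneq (p \o x \o q) 0.
    rewrite big1_seq // => p' /= /Fp[Pp' pp' _].
    rewrite big1_seq // => q' /= /Fq[Pq' qq' _].
    rewrite /f ifT //; apply/eqP; rewrite -(subprojC (Ps _ ps) Pp' pp') -qq'.
    rewrite -[LHS]/(p' \o (p \o x \o q) \o q') p0.
    by apply/funext => h; have [Mp' _ _] := Pp'; exact: (lin0 (vN_linear vM Mp')).
  rewrite -(tr_sum _ Sp); last by move=> r /Fp[].
  rewrite -(tr_sum _ Sq); last by move=> r /Fq[].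
  rewrite mulr_suml; apply: ler_sum_seq => p' /Fp[Pp' _ _].
  rewrite mulr_sumr; apply: ler_sum_seq => q' /Fq[Pq' _ _].
  by rewrite /f; case: ifP => // _; rewrite mulr_ge0 // (tr_ge0 ht).
Qed.

End Refinement.

(** * Generators *)

Section Combinatorics.
Context {R : realType} {H : completeNormedModType R[i]}.
Context {dot : {dot H for Num.conj}} (hd : hilbert dot).
Context {M : set (H -> H)} (hM : II1_factor dot M).
Context {tau : (H -> H) -> R[i]} (ht : faithful_normal_trace dot M tau).
Implicit Types (x y z p q r a b : H -> H) (h k u v : H) (A X Y P : set (H -> H)).

Let vM : vN_algebra dot M. Proof. by case: hM => -[]. Qed.
Let M1 : M idfun. Proof. by case: hM => -[]. Qed.
Local Notation tr := (trace_re tau).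
Local Notation cost := (@cost R H tau).

Lemma vN_generated_eq X Y : vN_generated dot X = M -> Y `<=` M ->
  (forall A, vN_algebra dot A -> Y `<=` A -> X `<=` A) -> vN_generated dot Y = M.
Proof.
move=> XM YM YX; apply/seteqP; split; first exact: smallest_sub.
by rewrite -XM => a Xa A [vA YA]; apply: Xa; split=> //; apply: YX.
Qed.

(** * Costs and corners along a fine partition *)

Section FinePartition.
Context {t : seq (H -> H)} {e : R} (ut : uniq t).
Context (tP : forall p, p \in t -> projections dot M p /\ tr p <= e).
Context (tO : forall p q, p \in t -> q \in t -> p <> q -> p \o q = 0).
Context (tS : \sum_(p <- t) p = idfun).

Let Pt p : p \in t -> projections dot M p. Proof. by move=> /tP[]. Qed.
Let tr0t p : p \in t -> 0 <= tr p. Proof. by move=> /Pt; exact: (tr_ge0 ht). Qed.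

Lemma fine_partition : projection_partitions dot M [set` t].
Proof.
split; [exact: finite_seq|by move=> p /Pt|exact: tO|by rewrite -fsbig_seq].
Qed.

(** Only an inequality: the list may repeat an operator, which the set counts once. *)
Lemma I_part_le_cost (s : seq (H -> H)) :
  I_part tau [set` s] [set` t] <= \sum_(x <- s) cost x t.
Proof.
have -> : [set` s] = [set` undup s] by apply/seteqP; split=> x /=; rewrite mem_undup.
rewrite /I_part -fsbig_seq ?undup_uniq //.
under eq_bigr do rewrite I_elt_cost //.
have c0 x : 0 <= cost x t.
  rewrite /cost big_seq; apply: sumr_ge0 => p pt.
  rewrite big_seq; apply: sumr_ge0 => q qt.
  by case: ifP => // _; rewrite mulr_ge0 // tr0t.
elim: s => [|x s IH]; first by rewrite !big_nil.
rewrite [in leRHS]big_cons /=; case: ifP => _; last by rewrite big_cons lerD2l.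
by apply: (le_trans IH); rewrite lerDr.
Qed.

Lemma big_only (p : H -> H) (f : (H -> H) -> R) : p \in t ->
  (forall q, q \in t -> q != p -> f q = 0) -> \sum_(q <- t) f q = f p.
Proof.
move=> pt f0; rewrite (bigD1_seq p) //= big_seq_cond big1 ?addr0 //.
by move=> q /andP[]; exact: f0.
Qed.

(** Orthogonality kills every entry of the matrix of [p \o b \o q] along [t] except the one at
    [(p, q)]. *)
Lemma cost_corner p q b : p \in t -> q \in t -> M b ->
  cost (p \o b \o q) t = if p \o b \o q == 0 then 0 else tr p * tr q.
Proof.
move=> pt qt Mb; have [[Mp _ pp] [Mq _ qq]] := (Pt pt, Pt qt).
rewrite /cost (big_only pt); last first.
  move=> p' p't p'p; apply: big1_seq => q' _.
  rewrite ifT // -[X in X == _]/((p' \o p) \o b \o q \o q').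
  have -> : p' \o p = 0 by apply: tO => //; exact/eqP.
  by apply/eqP.
rewrite (big_only qt) => [|q' q't q'q].
  by rewrite -[X in if X == _ then _ else _]/((p \o p) \o b \o (q \o q)) pp qq.
rewrite ifT // -[X in X == _]/(p \o p \o b \o (q \o q')).
have -> : q \o q' = 0 by apply: tO => //; apply/eqP; rewrite eq_sym.
apply/eqP/funext => h /=; rewrite (lin0 (vN_linear vM Mb)).
by rewrite !(lin0 (vN_linear vM Mp)).
Qed.

Lemma cost_add x y : cost (x + y) t <= cost x t + cost y t.
Proof.
rewrite /cost -big_split /=; apply: ler_sum_seq => p pt.
rewrite -big_split /=; apply: ler_sum_seq => q qt.
have [Mp _ _] := Pt pt.
have tt : 0 <= tr p * tr q by rewrite mulr_ge0 // tr0t.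
have f0 z : 0 <= (if p \o z \o q == 0 then 0 else tr p * tr q) by case: ifP.
have [_|pxy] := eqVneq (p \o (x + y) \o q) 0; first by rewrite addr_ge0.
have [px|_] := eqVneq (p \o x \o q) 0; last by rewrite lerDl f0.
have [py|_] := eqVneq (p \o y \o q) 0; last by rewrite add0r.
case/eqP: pxy; apply/funext => h; rewrite -[LHS]/(p (x (q h) + y (q h))).
rewrite (linD _ _ (vN_linear vM Mp)).
by rewrite -[p (x _)]/((p \o x \o q) h) -[p (y _)]/((p \o y \o q) h) px py addr0.
Qed.

Lemma cost0 : cost 0 t = 0.
Proof.
apply: big1_seq => p /= /Pt[Mp _ _]; apply: big1_seq => q _; rewrite ifT //.
by apply/eqP/funext => h; exact: (lin0 (vN_linear vM Mp)).
Qed.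

Lemma cost_mem p : p \in t -> cost p t <= tr p ^+ 2.
Proof.
move=> pt; have [_ _ pp] := Pt pt.
have -> : cost p t = cost (p \o idfun \o p) t by congr cost; rewrite -{1}pp.
rewrite cost_corner // expr2; case: ifP => // _.
by rewrite mulr_ge0 // tr0t.
Qed.

(** The traces are at most [e] and add up to [1]. This pays for the partition itself, and for the
    diagonal corners of one generator. *)
Lemma sum_sqr_tr : \sum_(p <- t) tr p ^+ 2 <= e.
Proof.
apply: (@le_trans _ _ (\sum_(p <- t) tr p * e)).
  apply: ler_sum_seq => p pt; rewrite expr2 ler_wpM2l ?tr0t //.
  by have [] := tP pt.
rewrite -mulr_suml (tr_sum hM ht _ tS) ?(tr1 ht) ?mul1r //.
Qed.

Lemma corner_decomposition x : linear x ->
  x = \sum_(p <- t) \sum_(q <- t) (p \o x \o q).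
Proof.
move=> lx; have tS1 h : \sum_(p <- t) p h = h.
  by have := congr1 (fun f => f h) tS; rewrite fct_sumE.
apply/funext => h; rewrite fct_sumE -[LHS]tS1.
apply: eq_big_seq => p /Pt[Mp _ _]; rewrite fct_sumE -{1}(tS1 h).
by rewrite (lin_sum _ _ _ lx) (lin_sum _ _ _ (vN_linear vM Mp)).
Qed.

(** Only sums of corners are formed, so [A] need not be known to contain the identity. *)
Lemma vN_corners A x : vN_algebra dot A -> linear x ->
  (forall p q, p \in t -> q \in t -> A (p \o x \o q)) -> A x.
Proof.
move=> vA lx Apq; rewrite (corner_decomposition lx) big_seq.
elim/big_ind : _; first exact: (vN0 vA).
  by move=> a b Aa Ab; exact: (vND vA Aa Ab).
move=> p pt; rewrite big_seq; elim/big_ind : _; first exact: (vN0 vA).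
  by move=> a b Aa Ab; exact: (vND vA Aa Ab).
by move=> q qt; exact: Apq.
Qed.

(** The two corners are adjoint to each other. For self-adjoint [x] the pattern of nonzero corners
    is therefore symmetric. *)
Lemma corner_adj_eq0 x x' p q : is_adjoint dot x x' -> p \in t -> q \in t ->
  (q \o x' \o p == 0) = (p \o x \o q == 0).
Proof.
move=> xx' /Pt[Mp sp _] /Pt[Mq sq _].
have adj : is_adjoint dot (p \o x \o q) (q \o x' \o p).
  exact: (is_adjointM (is_adjointM sp xx') sq).
have adj' := is_adjoint_sym adj.
apply/eqP/eqP => e0; apply/funext => h; apply: (@dot_ext _ _ dot) => k.
  by rewrite adj e0 dot0l dot0r.
by rewrite adj' e0 dot0l dot0r.
Qed.

End FinePartition.

(** * Exchanging self-adjoint and arbitrary generators *)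

Lemma I_part_fset X P : finite_set X ->
  I_part tau X P = \sum_(x <- finmap.enum_fset (fset_set X)) I_elt tau x P.
Proof. by move=> fX; rewrite /I_part fsbig_finite. Qed.

Lemma half_sa X P (e : R) : finite_set X -> X `<=` self_adjoint_part dot M ->
  vN_generated dot X = M -> projection_partitions dot M P -> 0 < e ->
  exists Y Q, [/\ [/\ finite_set Y, Y `<=` M & vN_generated dot Y = M],
    projection_partitions dot M Q & I_part tau Y Q <= 2^-1 * I_part tau X P + e].
Proof.
move=> fX XM XG PP e0; pose xs : seq (H -> H) := finmap.enum_fset (fset_set X).
have Xxs : X = [set` xs] by rewrite -{1}(fset_setK fX).
have n0 : 0 < (size xs).+1%:R :> R by [].
(* The error is cut into [size xs + 1] shares [d]: one for the partition and one for each
   generator. *)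
have [|t [ut tP tO tS tc]] := fine_refinement hd hM ht (e := e / (size xs).+1%:R) PP.
  by rewrite divr_gt0.
set d := e / _ in tP.
have MX x : x \in xs -> M x /\ is_adjoint dot x x.
  by move=> xxs; apply: XM; rewrite Xxs.
(* The list order of [t] orders the partition; below the diagonal the generator is [0], which costs
   nothing. *)
pose g x p q : H -> H := if (index p t <= index q t)%N then p \o x \o q else 0.
pose Y := t ++ [seq g x pq.1 pq.2 | x <- xs, pq <- [seq (p, q) | p <- t, q <- t]].
have gY x p q : x \in xs -> p \in t -> q \in t -> g x p q \in Y.
  move=> xxs pt qt; rewrite mem_cat; apply/orP; right.
  by apply/allpairsP; exists (x, (p, q)); split=> //; apply/allpairsP; exists (p, q).
have YM : [set` Y] `<=` M.
  move=> y /=; rewrite mem_cat => /orP[/tP[[]] //|/allpairsP[[x pq] /= [/MX[Mx _]]]].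
  move=> /allpairsP[[p q] /= [/tP[[Mp _ _] _] /tP[[Mq _ _] _] ->] ->] /=.
  by rewrite /g; case: ifP => _; [exact/(vNM vM (vNM vM Mp Mx))|exact: (vN0 vM)].
exists [set` Y], [set` t]; split; last 1 first.
- apply: le_trans (I_part_le_cost ut tP Y) _.
  rewrite big_cat big_allpairs_dep /=.
  have -> : 2^-1 * I_part tau X P + e =
      d + \sum_(x <- xs) 2^-1 * (I_elt tau x P + 2 * d).
    rewrite I_part_fset // -/xs mulr_sumr.
    under [in RHS]eq_bigr do rewrite mulrDr (mulrA _ 2) mulVf ?pnatr_eq0 // mul1r.
    rewrite big_split /= [X in _ = _ + (_ + X)]big_const_seq count_predT iter_addr_0.
    rewrite addrCA; congr (_ + _).
    by rewrite -mulrS -mulr_natr divfK // gt_eqF.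
  apply: lerD.
    apply: le_trans (sum_sqr_tr tP tS).
    by apply: ler_sum_seq => p; exact: (cost_mem ut tP tO).
  apply: ler_sum_seq => x /MX[Mx sx]; rewrite big_allpairs /=.
  pose f p q : R := if p \o x \o q == 0 then 0 else tr p * tr q.
  pose G p q : R := if (index p t <= index q t)%N then f p q else 0.
  have f0 p q : p \in t -> q \in t -> 0 <= f p q.
    move=> /tP[Pp _] /tP[Pq _]; rewrite /f; case: ifP => // _.
    by rewrite mulr_ge0 // (tr_ge0 ht).
  have -> : \sum_(p <- t) \sum_(q <- t) cost (g x p q) t =
      \sum_(p <- t) \sum_(q <- t) G p q.
    apply: eq_big_seq => p pt; apply: eq_big_seq => q qt; rewrite /g /G.
    by case: ifP => _; [exact: (cost_corner ut tP tO)|exact: (cost0 tP)].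
  (* By symmetry the upper triangle, counted twice, is the whole matrix with its diagonal counted
     once more. *)
  have G2 : 2 * \sum_(p <- t) \sum_(q <- t) G p q <=
      cost x t + \sum_(p <- t) tr p ^+ 2.
    rewrite mulr_natl mulr2n {2}exchange_big /= -!big_split /=.
    apply: ler_sum_seq => p pt; rewrite -big_split /=.
    have -> : tr p ^+ 2 = \sum_(q <- t) if q == p then tr p ^+ 2 else 0.
      rewrite (big_only ut pt (f := fun q => if q == p then _ else _)) ?eqxx //.
      by move=> q _ /negbTE ->.
    rewrite -big_split /=; apply: ler_sum_seq => q qt; rewrite -/(f p q) /G.
    have fC : f q p = f p q by rewrite /f (corner_adj_eq0 tP sx) // mulrC.
    have [->|qp] := eqVneq q p.
      rewrite leqnn lerD2l /f; case: ifP => // _.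
      by rewrite exprn_ge0 // (tr_ge0 ht) //; case: (tP _ pt).
    rewrite addr0 fC; have [pq|pq|pq] := ltngtP; rewrite ?addr0 ?add0r //.
    by case/eqP: qp; rewrite -(nth_index 0 pt) pq nth_index.
  have := tc x Mx; have := sum_sqr_tr tP tS; have : 0 < d by rewrite divr_gt0.
  by move: G2; lra.
- split; [exact: finite_seq|exact: YM|].
  apply: vN_generated_eq XG YM _.
  move=> A vA YA x; rewrite Xxs => xxs; have [Mx sx] := MX x xxs.
  have Ag p q : p \in t -> q \in t -> (index p t <= index q t)%N -> A (p \o x \o q).
    by move=> pt qt pq; have := YA _ (gY x p q xxs pt qt); rewrite /g pq.
  apply: (vN_corners tP tS vA (vN_linear vM Mx)) => p q pt qt.
  have [pq|/ltnW qp] := leqP (index p t) (index q t); first exact: Ag.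
  (* A corner below the diagonal is the adjoint of the one above it, as [x] is self-adjoint. *)
  have [y Ay qy] := vN_adj vA (Ag q p qt pt qp).
  have [[[_ sp _] _] [[_ sq _] _]] := (tP p pt, tP q qt).
  rewrite -[_ \o q]/(p \o (x \o q)).
  by rewrite -(is_adjoint_uniq qy (is_adjointM (is_adjointM sq sx) sp)).
- exact: (fine_partition ut tP tO tS).
Qed.

Lemma double_gen X P (e : R) : finite_set X -> X `<=` M ->
  vN_generated dot X = M -> projection_partitions dot M P -> 0 < e ->
  exists Y Q, [/\ [/\ finite_set Y, Y `<=` self_adjoint_part dot M &
                       vN_generated dot Y = M],
    projection_partitions dot M Q & I_part tau Y Q <= 2 * I_part tau X P + e].
Proof.
move=> fX XM XG PP e0; pose xs : seq (H -> H) := finmap.enum_fset (fset_set X).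
have Xxs : X = [set` xs] by rewrite -{1}(fset_setK fX).
have n0 : 0 < (size xs).+1%:R :> R by [].
have [|t [ut tP tO tS tc]] := fine_refinement hd hM ht (e := e / (size xs).+1%:R) PP.
  by rewrite divr_gt0.
set d := e / _ in tP.
have MX x : x \in xs -> M x by move=> xxs; apply: XM; rewrite Xxs.
have /choice[s sE] : forall x, exists x', M x -> M x' /\ is_adjoint dot x x'.
  move=> x; have [/(vN_adj vM)[x' Mx' xx']|nMx] := pselect (M x); last by exists x.
  by exists x'.
pose g x p q : H -> H := (p \o x \o q) + (q \o s x \o p).
(* On the diagonal [g x p p] sees only the sum of [x] and its adjoint; [b] supplies the difference,
   made self-adjoint by the factor ['i]. *)
pose b x h : H := 'i *: (x h - s x h).
pose Y := t ++ [seq g x pq.1 pq.2 | x <- xs, pq <- [seq (p, q) | p <- t, q <- t]]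
  ++ [seq p \o b x \o p | x <- xs, p <- t].
have gY x p q : x \in xs -> p \in t -> q \in t -> g x p q \in Y.
  move=> xxs pt qt; rewrite !mem_cat; apply/orP; right; apply/orP; left.
  by apply/allpairsP; exists (x, (p, q)); split=> //; apply/allpairsP; exists (p, q).
have bY x p : x \in xs -> p \in t -> p \o b x \o p \in Y.
  move=> xxs pt; rewrite !mem_cat; apply/orP; right; apply/orP; right.
  by apply/allpairsP; exists (x, p).
have Mb x : M x -> M (b x).
  by move=> Mx; have [Msx _] := sE x Mx; exact/(vNZ vM)/(vNB vM).
have sb x : M x -> is_adjoint dot (b x) (b x).
  move=> Mx; have [Msx xs'] := sE x Mx; have s'x := is_adjoint_sym xs'.
  move=> h k; rewrite dotZl dotZr dotBl dotBr xs' s'x conjCi.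
  by rewrite mulNr -mulrN opprB.
have YM : [set` Y] `<=` self_adjoint_part dot M.
  move=> y /=; rewrite !mem_cat => /or3P[/tP[[]] //| |].
    move=> /allpairsP[[x pq] /= [/MX Mx /allpairsP[[p q] /= []]]].
    move=> /tP[[Mp sp _] _] /tP[[Mq sq _] _] -> -> /=; have [Msx sx] := sE x Mx.
    have adj := is_adjointM (is_adjointM sp sx) sq.
    split; first exact: (vND vM (vNM vM (vNM vM Mp Mx) Mq) (vNM vM (vNM vM Mq Msx) Mp)).
    move=> h k; rewrite -[g x p q h]/((p \o x \o q) h + (q \o s x \o p) h).
    rewrite -[g x p q k]/((p \o x \o q) k + (q \o s x \o p) k) dotDl dotDr.
    by rewrite addrC (is_adjoint_sym adj) adj.
  move=> /allpairsP[[x p] /= [/MX Mx /tP[[Mp sp _] _] ->]]; split.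
    exact/(vNM vM (vNM vM Mp (Mb _ Mx))).
  exact: (is_adjointM (is_adjointM sp (sb _ Mx)) sp).
exists [set` Y], [set` t]; split; last 1 first.
- apply: le_trans (I_part_le_cost ut tP Y) _.
  rewrite !big_cat !big_allpairs_dep /= -big_split /=.
  have -> : 2 * I_part tau X P + e = d + \sum_(x <- xs) (2 * I_elt tau x P + d).
    rewrite I_part_fset // -/xs mulr_sumr.
    rewrite big_split /= [X in _ = _ + (_ + X)]big_const_seq count_predT iter_addr_0.
    rewrite addrCA; congr (_ + _).
    by rewrite -mulrS -mulr_natr divfK // gt_eqF.
  apply: lerD.
    apply: le_trans (sum_sqr_tr tP tS).
    by apply: ler_sum_seq => p; exact: (cost_mem ut tP tO).
  apply: ler_sum_seq => x /MX Mx; rewrite big_allpairs /=; apply: lerD; last first.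
    apply: le_trans (sum_sqr_tr tP tS); apply: ler_sum_seq => p pt.
    rewrite (cost_corner ut tP tO pt pt (Mb _ Mx)) -expr2; case: ifP => // _.
    by rewrite exprn_ge0 // (tr_ge0 ht) //; case: (tP _ pt).
  have [Msx sx] := sE x Mx.
  apply: le_trans (ler_wpM2l _ (tc x Mx)); last by [].
  rewrite /cost mulr_sumr; apply: ler_sum_seq => p pt.
  rewrite mulr_sumr; apply: ler_sum_seq => q qt.
  apply: le_trans (cost_add tP _ _) _.
  rewrite !(cost_corner ut tP tO) // (corner_adj_eq0 tP sx) // [tr q * _]mulrC.
  by rewrite mulr_natl mulr2n.
- split; [exact: finite_seq|exact: YM|].
  apply: vN_generated_eq XG (fun y Yy => (YM y Yy).1) _.
  move=> A vA YA x; rewrite Xxs => xxs; have Mx := MX x xxs.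
  have tA p : p \in t -> A p by move=> pt; apply: YA; rewrite /= mem_cat pt.
  apply: (vN_corners tP tS vA (vN_linear vM Mx)) => p q pt qt.
  have [[Pp _] [Pq _]] := (tP p pt, tP q qt).
  have [[Mp sp pp] [Mq sq qq]] := (Pp, Pq); have [Msx _] := sE x Mx.
  have lp := vN_linear vM Mp.
  have Ag := YA _ (gY x p q xxs pt qt).
  have [qp|/eqP qp] := eqVneq q p.
    (* The diagonal corner is half of [g x p p - 'i (p b p)]. *)
    rewrite qp in Ag *; have := vNP vA (- 'i) (YA _ (bY x p xxs pt)) Ag.
    move=> /(vNZ vA 2^-1); congr (A _); apply/funext => h.
    rewrite -[g x p p h]/(p (x (p h)) + p (s x (p h))) /= /b (linZ _ _ lp).
    rewrite (linB _ _ lp) scalerA mulNr -expr2 sqrCi opprK scale1r addrCA.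
    by rewrite subrK -mulr2n -[p _ *+ 2]scaler_nat scalerA mulVf ?scale1r // pnatr_eq0.
  (* Compressing [g x p q] by [p] on the left and [q] on the right kills its second summand, since
     [p q = 0]. *)
  have := vNM vA (vNM vA (tA p pt) Ag) (tA q qt); congr (A _); apply/funext => h.
  rewrite -[LHS]/(p (p (x (q (q h))) + q (s x (p (q h))))) (linD _ _ lp).
  rewrite !(proj_idem _ Pp) !(proj_idem _ Pq).
  rewrite -[p (q h)]/((p \o q) h) tO ?(lin0 (vN_linear vM Msx)) //; last exact/nesym.
  by rewrite (lin0 (vN_linear vM Mq)) (lin0 lp) addr0.
- exact: (fine_partition ut tP tO tS).
Qed.


End Combinatorics.

(** Both inequalities of the theorem are instances, with [c] equal to [1/2] and [2]. Dividing by [c]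
    first leaves bare infima to bound from below, infinite values included. *)
Lemma ereal_inf_I_set_le {R : realType} {H : completeNormedModType R[i]}
    (dot : {dot H for Num.conj}) (M : set (H -> H)) (tau : (H -> H) -> R[i])
    (c : R) (S S' : set (set (H -> H))) : 0 < c ->
  (forall X P (e : R), S X -> projection_partitions dot M P -> 0 < e ->
    exists Y Q, [/\ S' Y, projection_partitions dot M Q &
                    I_part tau Y Q <= c * I_part tau X P + e]) ->
  (ereal_inf [set I_set dot M tau Y | Y in S'] <=
   c%:E * ereal_inf [set I_set dot M tau X | X in S])%E.
Proof.
move=> c0 SS'; rewrite -lee_pdivrMl //; apply: le_ereal_inf_tmp => _ [X SX <-].
apply: le_ereal_inf_tmp => _ [P PP <-]; rewrite lee_pdivrMl // -EFinM.
apply/lee_addgt0Pr => e e0; have [Y [Q [S'Y PQ YQ]]] := SS' X P e SX PP e0.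
apply: ge_ereal_inf; exists (I_set dot M tau Y); first by exists Y.
apply: ge_ereal_inf; exists (I_part tau Y Q)%:E; first by exists Q.
by rewrite -EFinD lee_fin.
Qed.

Theorem theorem5p5 (R : realType) (H : completeNormedModType R[i])
    (dot : {dot H for Num.conj}) (M : set (H -> H)) (tau : (H -> H) -> R[i]) :
  hilbert dot -> II1_factor dot M -> faithful_normal_trace dot M tau ->
  G_gen dot M tau = ((2^-1)%:E * G_sa dot M tau)%E.
Proof.
move=> hd hM ht; apply/eqP; rewrite eq_le; apply/andP; split.
  apply: ereal_inf_I_set_le; first by rewrite invr_gt0.
  by move=> X P e [fX XM XG]; exact: half_sa.
rewrite lee_pdivrMl //; apply: ereal_inf_I_set_le => //.
by move=> X P e [fX XM XG]; exact: double_gen.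
Qed.
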